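(* Let $\tilde{\mathcal P}(z)$ be the polynomial of degree $p+q$ in $z$, with coefficients polynomial in the variables $c_k$, defined by $$\tilde{\mathcal P}(z)=\sum_{r=p-q}^{p+q}(-1)^rF_{r+1}\,\mathcal H_r(z),\qquad F_r=\frac{\partial}{\partial c_r}\det(c_{p-q+1+i+j})_{0\le i,j\le q},$$ where $\mathcal H_r(z)=z^r-c_1z^{r-1}+c_2z^{r-2}-\dots+(-1)^rc_r$ for $r\ge0$ and $\mathcal H_r=0$ for $r<0$. For an even operator $A$ in a $p|q$-dimensional superspace let $\tilde{\mathcal P}_A(z)$ be the result of substituting $c_k=c_k(A)=\operatorname{Tr}\Lambda^kA$ in $\tilde{\mathcal P}(z)$. Then: (1) $\tilde{\mathcal P}_A(z)$ is an annihilating polynomial for any even operator $A$ in a $p|q$-dimensional superspace, i.e. $\tilde{\mathcal P}_A(A)=0$, and its coefficients are invariant polynomial functions of $A$. (2) For generic operators $A$, $\tilde{\mathcal P}_A(z)$ is a minimal polynomial, which divides all annihilating polynomials for $A$. (3) The identity $$\tilde{\mathcal P}_A(z)=R\cdot\mathcal P_A(z)$$ holds, where $\mathcal P_A(z)=\prod_{i=1}^p(\lambda_i-z)\prod_{\alpha=1}^q(\mu_\alpha-z)$ is the naive characteristic polynomial, whose coefficients are rational invariant functions of $A$, and $R=\prod_{i,\alpha}(\lambda_i-\mu_\alpha)=\operatorname{Res}(R^-_A,R^+_A)$. Here $\lambda_i,\mu_\alpha$ are the eigenvalues of $A$.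
   Context: Let $\mathcal A=\mathcal A_0\oplus\mathcal A_1$ be a $\mathbb Z_2$-graded supercommutative algebra over $\mathbb C$. A $p|q$-dimensional superspace $V$ means a free $\mathbb Z_2$-graded $\mathcal A$-module of rank $p|q$. An even operator $A$ is given by a block matrix $\begin{pmatrix} A_{00} & A_{01} \\ A_{10} & A_{11} \end{pmatrix}$ with entries of $A_{00}$ ($p\times p$) and $A_{11}$ ($q\times q$) in $\mathcal A_0$ and entries of $A_{01},A_{10}$ in $\mathcal A_1$. $\operatorname{Tr}$ denotes the supertrace, $\operatorname{Tr}A=\operatorname{Tr}A_{00}-\operatorname{Tr}A_{11}$. $\Lambda^kV$ is the $k$-th exterior power in the super sense: the degree-$k$ part of the quotient of the tensor algebra $T(V)$ by the ideal generated by $v\otimes u+(-1)^{\tilde v\tilde u}u\otimes v$ for homogeneous $u,v$ of parities $\tilde u,\tilde v$, with inherited $\mathbb Z_2$-grading; $\Lambda^kA$ is the induced operator; $c_k(A)=0$ for $k<0$ and $c_0(A)=1$. In the partial derivatives $F_r$ all $c_k$ are treated as independent variables. A function of $A$ is invariant if it is unchanged under $A\mapsto C^{-1}AC$ for every even invertible $C$; it is polynomial (rational) if it is polynomial (rational) in the matrix entries. An annihilating polynomial for $A$ is a polynomial $f(z)$ with $f(A)=0$. The eigenvalues $\lambda_1,\dots,\lambda_p$ correspond to even eigenvectors and $\mu_1,\dots,\mu_q$ to odd eigenvectors. The operator $A$ is generic if all the differences $\lambda_i-\lambda_j$ ($i\ne j$), $\lambda_i-\mu_\alpha$, $\mu_\alpha-\mu_\beta$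 ($\alpha\neq\beta$) are invertible. $R^+_A(z)=\prod_i(1+\lambda_iz)$ and $R^-_A(z)=\prod_\alpha(1+\mu_\alpha z)$ are the numerator and denominator of the characteristic function $\operatorname{Ber}(1+zA)=R^+_A(z)/R^-_A(z)$, where $\operatorname{Ber}M=\det(M_{00}-M_{01}M_{11}^{-1}M_{10})/\det M_{11}$ is the Berezinian; $\operatorname{Res}(R^-_A,R^+_A)$ is their (Sylvester) resultant, in the sign convention in which it equals $\prod_{i,\alpha}(\lambda_i-\mu_\alpha)$.
   Formalization: The identity in (3) is proved with an extra sign (-1)^{q(q-1)/2} on the right; as printed it fails, e.g. for p=0, q=2, where the leading coefficient is F_3 = c_{-1}c_1 - c_0^2 = -1 while R P_A(z) has +1. Eigenvalues are taken from a homogeneous basis of eigenvectors. *)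

(* Defs.v *)
From HB Require Import structures.
From mathcomp Require Import all_boot all_order all_algebra.
From mathcomp Require Import boolp classical_sets functions reals.
From mathcomp Require Import complex.
From mathcomp Require Import mpoly.

Set Implicit Arguments.
Unset Strict Implicit.
Unset Printing Implicit Defensive.

Import GRing.Theory.
Local Open Scope ring_scope.

(* A Z/2-grading A = A_0 (+) A_1 making A supercommutative, given by its two
   projections: gproj b is the projection onto A_b ([true] is odd), so that
   A_b = {x | gproj b x = x}.                                                 *)
Record supercomm_grading (K : fieldType) (A : algType K) := SupercommGrading {
  gproj : bool -> {linear A -> A};
  gproj_proj : forall a b x, gproj a (gproj b x) = if a == b then gproj b x else 0;
  gproj_sum : forall x, gproj false x + gproj true x = x;
  gproj_mul : forall a b x y, gproj a x = x -> gproj b y = y ->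
    gproj (a (+) b) (x * y) = x * y;
  gproj_supercomm : forall a b x y, gproj a x = x -> gproj b y = y ->
    x * y = (-1) ^+ (a && b) * (y * x)
}.

Definition invertible (A : pzRingType) (x : A) : Prop :=
  exists y, x * y = 1 /\ y * x = 1.

(* Left scalar multiplication; for the even coefficients of the polynomials
   below it is the action of A on operators, and for arbitrary coefficients the
   vanishing of the value does not depend on left/right sign conventions.     *)
Definition mxeval (A : nzRingType) n (M : 'M[A]_n) (f : {poly A}) : 'M[A]_n :=
  \sum_(k < size f) f`_k *: M ^+ k.

Definition annihilates (A : nzRingType) n (f : {poly A}) (M : 'M[A]_n) : Prop :=
  mxeval M f = 0.

Definition minimal_poly (A : nzRingType) n (P : {poly A}) (M : 'M[A]_n) : Prop :=
  [/\ P != 0, annihilates P M &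
      forall f : {poly A}, f != 0 -> annihilates f M -> (size P <= size f)%N].

(* The Sylvester resultant of f, g regarded as polynomials of degrees m, n
   (their actual degrees may drop), with ascending coefficients as in
   [Sylvester_mx].  With this convention
   Res(prod_a (1 + mu_a z), prod_i (1 + lam_i z)) = prod_(i,a) (lam_i - mu_a);
   for descending coefficients the sign would be (-1)^(m n).                  *)
Definition formal_resultant (A : nzRingType) (m n : nat) (f g : {poly A}) : A :=
  \det (col_mx (\matrix_(i < n, j < n + m) ('X^i * f)`_j)
               (\matrix_(i < m, j < n + m) ('X^i * g)`_j)).

Section Superspace.

Variables (K : fieldType) (A : algType K) (gr : supercomm_grading A) (p q : nat).

Definition has_parity (a : bool) (x : A) : Prop := gproj gr a x = x.

(* The superspace A^{p|q} with standard homogeneous basis e_i, i < p + q, of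
   which the first p are even.  Scalars are written on the right of the basis
   vectors, so that M e_j = sum_i e_i M_ij.                                   *)
Definition ipar (i : 'I_(p + q)) : bool := (p <= i)%N.

Definition wpar (w : seq 'I_(p + q)) : bool := odd (count ipar w).

Definition even_mx (M : 'M[A]_(p + q)) : Prop :=
  forall i j, has_parity (ipar i (+) ipar j) (M i j).

Definition vhomog (a : bool) (v : 'cV[A]_(p + q)) : Prop :=
  forall i, has_parity (a (+) ipar i) (v i 0).

(* t : tensor stands for sum_w e_w t(w) over words w, where
   e_w = e_(w_1) (x) ... (x) e_(w_k).                                         *)
Definition tensor : Type := seq 'I_(p + q) -> A.

Definition tfinite (t : tensor) : Prop :=
  exists N, forall w, (N < size w)%N -> t w = 0.

Definition tdegree (k : nat) (t : tensor) : Prop :=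
  forall w, size w != k -> t w = 0.

Definition thomog (a : bool) (t : tensor) : Prop :=
  forall w, has_parity (a (+) wpar w) (t w).

(* a e_v = e_v (twist |v| a) *)
Definition twist (b : bool) (a : A) : A :=
  gproj gr false a + (-1) ^+ b * gproj gr true a.

Definition tone : tensor := fun w => (w == [::])%:R.

Definition tvec (v : 'cV[A]_(p + q)) : tensor :=
  fun w => if w is [:: i] then v i 0 else 0.

(* (e_u a) (x) (e_v b) = e_(uv) (twist |v| a) b *)
Definition tmul (t s : tensor) : tensor := fun w =>
  \sum_(j < (size w).+1) twist (wpar (drop j w)) (t (take j w)) * s (drop j w).

Inductive ext_ideal : tensor -> Prop :=
| ext_ideal_gen a b u v : vhomog a u -> vhomog b v ->
    ext_ideal (fun w => tmul (tvec v) (tvec u) w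
                        + (-1) ^+ (a && b) * tmul (tvec u) (tvec v) w)
| ext_ideal0 : ext_ideal (fun=> 0)
| ext_idealD t s : ext_ideal t -> ext_ideal s -> ext_ideal (fun w => t w + s w)
| ext_idealMl x t : tfinite x -> ext_ideal t -> ext_ideal (tmul x t)
| ext_idealMr t x : tfinite x -> ext_ideal t -> ext_ideal (tmul t x).

(* The algebra endomorphism of T(V) extending the even operator M. *)
Definition tensor_map (M : 'M[A]_(p + q)) (t : tensor) : tensor := fun w =>
  \sum_(u : (size w).-tuple 'I_(p + q))
    foldr (fun j => tmul (tvec (col j M))) tone u w * t u.

Definition tcomb m (b : 'I_m -> tensor) (x : 'I_m -> A) : tensor :=
  fun w => \sum_i b i w * x i.

(* b_0, ..., b_(m-1) represent a basis of Lambda^k V = T^k / (T^k `&` ideal),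
   homogeneous of parities s_0, ..., s_(m-1).                                 *)
Definition ext_basis (k m : nat) (s : 'I_m -> bool) (b : 'I_m -> tensor) : Prop :=
  [/\ forall i, tdegree k (b i),
      forall i, thomog (s i) (b i),
      forall t, tdegree k t ->
        exists x : 'I_m -> A, ext_ideal (fun w => t w - tcomb b x w) &
      forall x : 'I_m -> A, ext_ideal (tcomb b x) -> forall i, x i = 0].

Definition supertrace m (s : 'I_m -> bool) (N : 'M[A]_m) : A :=
  \sum_i (-1) ^+ (s i) * N i i.

Definition is_ext_trace (k : nat) (M : 'M[A]_(p + q)) (c : A) : Prop :=
  exists m (s : 'I_m -> bool) (b : 'I_m -> tensor) (N : 'M[A]_m),
    [/\ ext_basis k s b,
        forall j, ext_ideal (fun w => tensor_map M (b j) w - tcomb b (N^~ j) w) &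
        c = supertrace s N].

(* c_k(M) = Tr Lambda^k M; the supertrace does not depend on the basis. *)
Definition ext_trace (k : int) (M : 'M[A]_(p + q)) : A :=
  if k is Posz m then xget 0 [set c | is_ext_trace m M c]%classic else 0.

(* C is even and invertible, with inverse Ci (which is then even too). *)
Definition even_invertible_mx (C Ci : 'M[A]_(p + q)) : Prop :=
  [/\ even_mx C, C *m Ci = 1%:M & Ci *m C = 1%:M].

(* The columns of C are a homogeneous basis of eigenvectors: p even ones, with
   eigenvalues lam, followed by q odd ones, with eigenvalues mu.              *)
Definition eigenvalues (M : 'M[A]_(p + q)) (lam : 'rV[A]_p) (mu : 'rV[A]_q) : Prop :=
  [/\ forall i, has_parity false (lam 0 i), forall a, has_parity false (mu 0 a) &
      exists C Ci, even_invertible_mx C Ci /\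
                   M *m C = C *m diag_mx (row_mx lam mu)].

Definition generic (lam : 'rV[A]_p) (mu : 'rV[A]_q) : Prop :=
  [/\ forall i j, i != j -> invertible (lam 0 i - lam 0 j),
      forall i a, invertible (lam 0 i - mu 0 a) &
      forall a b, a != b -> invertible (mu 0 a - mu 0 b)].

(* A list of terms (coefficient, word in the matrix positions): a polynomial in
   non-commuting letters, since odd matrix entries do not commute.            *)
Definition entry_poly : Type := seq (K * seq ('I_(p + q) * 'I_(p + q))).

Definition entry_eval (P : entry_poly) (M : 'M[A]_(p + q)) : A :=
  \sum_(m <- P) m.1 *: \prod_(ij <- m.2) M ij.1 ij.2.

Definition polynomial_fun (f : 'M[A]_(p + q) -> A) : Prop :=
  exists P : entry_poly, forall M, even_mx M -> f M = entry_eval P M.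

Definition rational_fun (D : 'M[A]_(p + q) -> Prop) (f : 'M[A]_(p + q) -> A) : Prop :=
  exists P Q : entry_poly, forall M, even_mx M -> D M ->
    invertible (entry_eval Q M) /\ f M * entry_eval Q M = entry_eval P M.

Definition invariant_fun (D : 'M[A]_(p + q) -> Prop) (f : 'M[A]_(p + q) -> A) : Prop :=
  forall M C Ci, even_mx M -> even_invertible_mx C Ci -> D M ->
    D (Ci *m M *m C) /\ f (Ci *m M *m C) = f M.

Definition naive_charpoly (lam : 'rV[A]_p) (mu : 'rV[A]_q) : {poly A} :=
  (\prod_(i < p) ((lam 0 i)%:P - 'X)) * \prod_(a < q) ((mu 0 a)%:P - 'X).

(* prod_i (1 + x_i z) *)
Definition charfactor n (x : 'rV[A]_n) : {poly A} :=
  \prod_(i < n) (1 + x 0 i *: 'X).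

(* The leading coefficient of [Ptilde] is (-1)^(p + q) times the Hankel
   determinant of (c_(p-q+1+i+j)) for i, j < q; evaluated at an operator with
   eigenvalues lam, mu that determinant is (-1)^(q (q - 1) / 2) times the
   product below.  E.g. for p = 0, q = 2 it is c_(-1) c_1 - c_0^2 = -1.       *)
Definition eigen_resultant (lam : 'rV[A]_p) (mu : 'rV[A]_q) : A :=
  \prod_(i < p) \prod_(a < q) (lam 0 i - mu 0 a).

End Superspace.

Section UniversalPolynomial.

Variables (K : fieldType) (p q : nat).

(* Independent variables c_k for -q <= k <= p + q + 1, c_k having index k + q;
   this range contains every index occurring below.                           *)
Definition nvars : nat := (p + q + q).+2.

Definition cidx (k : int) : 'I_nvars := inord (absz (k + q%:Z)).

Definition cvar (k : int) : {mpoly K[nvars]} := 'X_(cidx k).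

Definition hankel_det : {mpoly K[nvars]} :=
  \det (\matrix_(i < q.+1, j < q.+1) cvar (p%:Z - q%:Z + 1 + i%:Z + j%:Z)).

Definition Fder (r : int) : {mpoly K[nvars]} := mderiv (cidx r) hankel_det.

Definition Hpoly (r : int) : {poly {mpoly K[nvars]}} :=
  if r is Posz m then
    'X^m + \sum_(1 <= j < m.+1) ((-1) ^+ j * cvar j%:Z) *: 'X^(m - j)
  else 0.

Definition Ptilde : {poly {mpoly K[nvars]}} :=
  \sum_(s < (2 * q).+1)
    let r := p%:Z - q%:Z + s%:Z in
    ((-1) ^+ absz r * Fder (r + 1)) *: Hpoly r.

End UniversalPolynomial.

(* Ptilde with c_k(M) substituted for c_k. *)
Definition Ptilde_at (K : fieldType) (A : algType K) (gr : supercomm_grading A)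
    (p q : nat) (M : 'M[A]_(p + q)) : {poly A} :=
  map_poly (mmap (fun c : K => c%:A)
                 (fun j : 'I_(nvars p q) => ext_trace gr (j%:Z - q%:Z) M))
           (Ptilde K p q).

(* Main.v *)
(* Let c_k be the coefficients of prod_i (1 + l_i x) / prod_a (1 + m_a x) over a
   commutative ring.  The denominator gives a null vector b, with last entry 1,
   of the symmetric Hankel matrix H_(q+1) = (c_(p-q+1+i+j))_(i,j<=q), so that the
   adjugate of H_(q+1) is det(H_q) b b^T; contracting it with the coefficients of
   prod (1 + l_i x) / (prod (1 + m_a x) (1 + z x)) gives
   Ptilde(z) = det(H_q) prod_i (l_i - z) prod_a (m_a - z), and row and column
   operations give det(H_q) = (-1)^(q(q-1)/2) prod_(i,a) (l_i - m_a).

   In the basis of Lambda^k V indexed by sorted words, Tr Lambda^k M is one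
   polynomial in the entries of M, invariant under conjugation, and for an M with
   eigenvalues it is the above c_k.

   For an arbitrary even M, fix D = diag(0, 1, 2, ...).  Over A[[s]] the operator
   M_s = D + s (M - D) is diagonalizable, because the eigenvalues of D are
   distinct, so it is annihilated by its polynomial Ptilde.  The entries of
   Ptilde_(M_s)(M_s) are polynomials in s; being 0 they also vanish at s = 1.   *)

Require Import Defs.
From HB Require Import structures.
From mathcomp Require Import all_boot all_order all_algebra.
From mathcomp Require Import boolp classical_sets reals complex mpoly perm zify ring.

Set Implicit Arguments.
Unset Strict Implicit.
Unset Printing Implicit Defensive.

Import GRing.Theory.
Local Open Scope ring_scope.

(** * Coefficients of rational functions *)

(** An even operator need not have eigenvalues: [A] may contain nilpotents, M may be a Jordan block,
    and [A] carries no topology for a density argument. Formal perturbation from D takes the place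
    of density. Power series are needed for the eigenvectors of M_s, while the identity to be proved
    is polynomial in s; to see this, the traces must be given by one polynomial valid over every
    superalgebra, A[[s]] included.

    [ext_trace] picks by choice a supertrace in some basis of a quotient that is never formed.
    Membership in the ideal is therefore tested by alternating functionals on words: they give
    coordinates, and with them the independence of the basis. This uses that 2 is invertible, since
    the relations only yield 2 e_x e_x = 0 for an even letter x.

    [A] is not commutative, so determinants and substitutions into polynomials misbehave over it.
    All commutative algebra is done over a commutative ring and carried to [A] through its subring
    of even elements, which is central.

    The sign (-1)^(q(q-1)/2) comes from reversing the rows of a Hankel matrix; the resulting
    Toeplitz determinant is exactly the resultant. *)

Section Coefficients.
Variable S : comNzRingType.
Implicit Types (f g : int -> S) (l m z : S) (ls ms : seq S).

Definition vanish_neg f := forall n, f (Negz n) = 0.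

(* A sequence vanishing in negative degrees is a power series; [mulseq l] and
   [divseq m] multiply and divide it by the linear factors 1 + l x, 1 + m x.  *)
Definition mulseq l f (k : int) : S := f k + l * f (k - 1).
Definition divseq m f (k : int) : S :=
  if k is Posz n then \sum_(j < n.+1) (- m) ^+ j * f (n - j)%N else 0.
Definition oneseq (k : int) : S := (k == 0)%:R.
Definition supercoef ls ms : int -> S :=
  foldr divseq (foldr mulseq oneseq ls) ms.
Definition linfactors ls : {poly S} := \prod_(l <- ls) (1 + l *: 'X).

Lemma divseq_neg m f : vanish_neg (divseq m f). Proof. by []. Qed.

Lemma vanish_lt0 f k : vanish_neg f -> k < 0 -> f k = 0.
Proof. by case: k => // n ->. Qed.

Lemma mulseq_neg l f : vanish_neg f -> vanish_neg (mulseq l f).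
Proof. by move=> f0 n; rewrite /mulseq !vanish_lt0 ?mulr0 ?addr0 //; lia. Qed.

Lemma oneseq_neg : vanish_neg oneseq. Proof. by []. Qed.

Lemma divseqE m f k : vanish_neg f -> divseq m f k + m * divseq m f (k - 1) = f k.
Proof.
move=> f0; case: k => [[|n]|n]; last by rewrite /divseq f0 /= mulr0 addr0.
  by rewrite /divseq /= big_ord1 expr0 mul1r mulr0 addr0.
rewrite (_ : n.+1%:Z - 1 = n); last by lia.
rewrite /divseq big_ord_recl expr0 mul1r subn0 mulr_sumr -addrA -big_split /=.
rewrite big1 ?addr0 // => j _; rewrite /bump /= add1n subSS exprS.
by rewrite mulrA !mulNr addNr.
Qed.

(** The relation is a recursion in k that starts from the zeros in negative degrees. It identifies
    quotients without touching the sum that defines [divseq]. *)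
Lemma divseq_unique m f g : vanish_neg f -> vanish_neg g ->
  (forall k, g k + m * g (k - 1) = f k) -> g =1 divseq m f.
Proof.
move=> f0 g0 gE [n|n]; last by rewrite g0.
elim: n => [|n IHn].
  by rewrite -[LHS]addr0 -[X in _ + X](mulr0 m) -(g0 0%N) gE /divseq big_ord1 mul1r.
apply: (@addIr _ (m * g n)); rewrite [in RHS]IHn.
have := divseqE m n.+1 f0; rewrite -gE (_ : n.+1%:Z - 1 = n); last by lia.
by move=> ->.
Qed.

Lemma eq_divseq m f g : f =1 g -> divseq m f =1 divseq m g.
Proof. by move=> fg [n|n] //=; apply: eq_bigr => j _; rewrite fg. Qed.

Lemma eq_mulseq l f g : f =1 g -> mulseq l f =1 mulseq l g.
Proof. by move=> fg k; rewrite /mulseq !fg. Qed.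

Lemma divseq_mulseq m l f : vanish_neg f ->
  divseq m (mulseq l f) =1 mulseq l (divseq m f).
Proof.
move=> f0 k; apply/esym; apply: divseq_unique => [||{}k].
- exact: mulseq_neg.
- exact/mulseq_neg/divseq_neg.
by rewrite /mulseq -[in RHS](divseqE m k f0) -[in RHS](divseqE m (k - 1) f0); ring.
Qed.

Lemma foldr_mulseq_neg ls f : vanish_neg f -> vanish_neg (foldr mulseq f ls).
Proof. by move=> f0; elim: ls => //= l ls; apply: mulseq_neg. Qed.

Lemma foldr_divseq_neg ms f : vanish_neg f -> vanish_neg (foldr divseq f ms).
Proof. by case: ms. Qed.

Lemma supercoef_neg ls ms : vanish_neg (supercoef ls ms).
Proof. exact/foldr_divseq_neg/foldr_mulseq_neg/oneseq_neg. Qed.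

Lemma supercoef0 ls ms : supercoef ls ms 0 = 1.
Proof.
rewrite /supercoef; elim: ms => [|m ms IHms] /=; last by rewrite big_ord1 mul1r subnn.
elim: ls => [|l ls IHls] //=.
by rewrite /mulseq IHls vanish_lt0 ?mulr0 ?addr0 //; apply/foldr_mulseq_neg/oneseq_neg.
Qed.

(** Multiplications and divisions commute, so that a factor of the numerator can be peeled off as
    easily as one of the denominator. *)
Lemma supercoef_mulr ls ms : supercoef ls ms =1 foldr mulseq (foldr divseq oneseq ms) ls.
Proof.
rewrite /supercoef; elim: ms => [|m ms IHms] //= k.
rewrite (eq_divseq _ IHms); elim: ls k {IHms} => [|l ls IHls] //= k.
rewrite divseq_mulseq ?(eq_mulseq _ IHls) //.
exact/foldr_mulseq_neg/foldr_divseq_neg/oneseq_neg.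
Qed.

Lemma supercoef_consl l ls ms : supercoef (l :: ls) ms =1 mulseq l (supercoef ls ms).
Proof. by move=> k; rewrite supercoef_mulr /= (eq_mulseq _ (supercoef_mulr ls ms)). Qed.

Lemma supercoef_consr m ls ms k :
  supercoef ls (m :: ms) k + m * supercoef ls (m :: ms) (k - 1) = supercoef ls ms k.
Proof. exact/divseqE/supercoef_neg. Qed.

Lemma size_linfactors ls : (size (linfactors ls) <= (size ls).+1)%N.
Proof.
rewrite /linfactors; elim: ls => [|l ls IHls] /=; first by rewrite big_nil size_poly1.
rewrite big_cons; apply: leq_trans (size_polyMleq _ _) _.
have: (size (1 + l *: 'X : {poly S})%R <= 2)%N.
  apply: leq_trans (size_polyD _ _) _; rewrite size_poly1 geq_max /=.
  by apply: leq_trans (size_scale_leq _ _) _; rewrite size_polyX.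
by move: (size _) (size _) IHls => a b; lia.
Qed.

Lemma coef_linfactors_cons l ls k :
  (linfactors (l :: ls))`_k = (linfactors ls)`_k + l * (if k is k'.+1 then (linfactors ls)`_k' else 0).
Proof.
rewrite /linfactors big_cons mulrDl mul1r coefD -scalerAl coefZ coefXM.
by case: k.
Qed.

Lemma linfactors0 ls : (linfactors ls)`_0 = 1.
Proof.
elim: ls => [|l ls IHls]; first by rewrite /linfactors big_nil coef1.
by rewrite coef_linfactors_cons mulr0 addr0.
Qed.

Lemma supercoef_nilr ls (k : nat) : supercoef ls [::] k = (linfactors ls)`_k.
Proof.
elim: ls k => [|l ls IHls] k; first by rewrite /linfactors big_nil coef1.
rewrite supercoef_consl /mulseq coef_linfactors_cons IHls.
case: k => [|k]; first by rewrite vanish_lt0 ?mulr0 //; apply: supercoef_neg.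
by rewrite (_ : k.+1%:Z - 1 = k) ?IHls //; lia.
Qed.

Lemma supercoef_nilr_gt ls (k : nat) : (size ls < k)%N -> supercoef ls [::] k = 0.
Proof.
by move=> h; rewrite supercoef_nilr nth_default //; apply: leq_trans (size_linfactors _) h.
Qed.

Lemma act_linfactors ms f k :  vanish_neg f ->
  \sum_(j < (size ms).+1) (linfactors ms)`_j * foldr divseq f ms (k - j%:Z) = f k.
Proof.
elim: ms f k => [|m ms IHms] f k f0.
  by rewrite big_ord1 linfactors0 mul1r /= subr0.
rewrite -[RHS](IHms f k f0).
under eq_bigr => j _ do rewrite coef_linfactors_cons mulrDl.
rewrite big_split /= big_ord_recr /= nth_default ?size_linfactors // mul0r addr0.
rewrite [X in _ + X]big_ord_recl mulr0 mul0r add0r -big_split /=.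
apply: eq_bigr => j _; rewrite -[in RHS](divseqE m (k - j%:Z) (foldr_divseq_neg ms f0)).
rewrite /bump add1n (_ : k - j.+1%:Z = k - j%:Z - 1); last by lia.
by ring.
Qed.

(** In degrees above [size ls] the right side vanishes: this is the linear recurrence of the c_k,
    the source of the null vector of the Hankel matrix. *)
Lemma act_linfactors_supercoef ls ms k :
  \sum_(j < (size ms).+1) (linfactors ms)`_j * supercoef ls ms (k - j%:Z) = supercoef ls [::] k.
Proof. exact/act_linfactors/foldr_mulseq_neg/oneseq_neg. Qed.

Lemma supercoef_conv ls ms (k : int) :
  \sum_(j < (size ls).+1) (linfactors ls)`_j * supercoef [::] ms (k - j%:Z) = supercoef ls ms k.
Proof.
elim: ls k => [|l ls IHls] k; first by rewrite big_ord1 linfactors0 mul1r subr0.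
rewrite supercoef_consl /mulseq -!IHls mulr_sumr.
under eq_bigr => j _ do rewrite coef_linfactors_cons mulrDl.
rewrite big_split /=; congr (_ + _).
  by rewrite big_ord_recr /= nth_default ?size_linfactors // mul0r addr0.
rewrite big_ord_recl mulr0 mul0r add0r; apply: eq_bigr => j _.
rewrite /= /bump add1n (_ : k - j.+1%:Z = k - 1 - j%:Z); last by lia.
by rewrite mulrA.
Qed.

Lemma sum_linfactors_rev ms z :
  \sum_(j < (size ms).+1) (linfactors ms)`_(size ms - j) * z ^+ j = \prod_(m <- ms) (m + z).
Proof.
elim: ms => [|m ms IHms]; first by rewrite big_ord1 big_nil linfactors0 mul1r.
rewrite big_cons -IHms mulrDl !mulr_sumr.
under eq_bigr => j _ do rewrite coef_linfactors_cons mulrDl.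
rewrite big_split /= addrC; congr (_ + _).
  rewrite big_ord_recr /= subnn mulr0 mul0r addr0; apply: eq_bigr => j _.
  by rewrite subSn -1?ltnS ?ltn_ord //; rewrite mulrA.
rewrite big_ord_recl nth_default ?size_linfactors //= mul0r add0r.
by apply: eq_bigr => j _; rewrite /bump add1n subSS exprS; ring.
Qed.

(* R^- w = R^+ / (1 + z x) as power series, whose coefficients beyond the degree
   of R^+ form a geometric progression.                                       *)
Lemma act_div_supercoef ls ms z w (i : nat) :
  vanish_neg w -> (forall k, w k + z * w (k - 1) = supercoef ls ms k) ->
  \sum_(j < (size ms).+1) (linfactors ms)`_j * w ((size ls + i)%N%:Z - j%:Z)
    = (- z) ^+ i * \prod_(l <- ls) (l - z).
Proof.
move=> w0 wE.
pose g k := \sum_(j < (size ms).+1) (linfactors ms)`_j * w (k - j%:Z).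
have g0 : vanish_neg g.
  by move=> n; apply: big1 => j _; rewrite vanish_lt0 ?mulr0 //; lia.
have gE k : g k + z * g (k - 1) = supercoef ls [::] k.
  rewrite -(act_linfactors_supercoef ls ms) /g mulr_sumr -big_split /=.
  apply: eq_bigr => j _; rewrite -wE (_ : k - 1 - j%:Z = k - j%:Z - 1); last by lia.
  by ring.
rewrite -/(g _) (divseq_unique _ g0 gE); last exact: supercoef_neg.
rewrite {w w0 wE g g0 gE ms}.
elim: ls i => [|l ls IHls] i.
  rewrite big_nil mulr1 /= big_ord_recr /= big1 => [|j _].
    by rewrite subnn mulr1 add0r.
  by rewrite /oneseq /=; case: eqP; rewrite ?mulr0 // => h; have := ltn_ord j; lia.
rewrite (eq_divseq _ (supercoef_consl l ls [::])) divseq_mulseq; last exact: supercoef_neg.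
rewrite /mulseq [size _]/= addSnnS IHls (_ : (size ls + i.+1)%N%:Z - 1 = (size ls + i)%N); last by lia.
by rewrite IHls big_cons exprS; ring.
Qed.

End Coefficients.

(** * Toeplitz, Hankel and Sylvester determinants *)

Section Determinants.
Variable S : comNzRingType.
Implicit Types (f g : int -> S) (l m z : S) (ls ms : seq S).

Lemma det_unitrig n (U : 'M[S]_n) :
  (forall i j : 'I_n, (j < i)%N -> U i j = 0) -> (forall i, U i i = 1) -> \det U = 1.
Proof.
move=> U0 U1; rewrite -det_tr det_trig; first by apply: big1 => i _; rewrite mxE.
by apply/is_trig_mxP => i j ij; rewrite mxE U0.
Qed.

Lemma sum_delta n (F : 'I_n -> S) j : \sum_k F k * (k == j)%:R = F j.
Proof.
rewrite (bigD1 j) //= eqxx mulr1 big1 ?addr0 // => k /negPf ->; exact: mulr0.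
Qed.

Definition toeplitz f (p q : nat) : 'M[S]_q := \matrix_(i, j) f (p%:Z + j%:Z - i%:Z).

(** Induction on the denominator. The column operations U cancel the factor 1 + m x in all columns
    but the first. The row operation L then applies the recurrence of the remaining denominator to
    the top row, which becomes 0 except for the corner entry prod (l - m). *)
Lemma det_toeplitz ls ms :
  \det (toeplitz (supercoef ls ms) (size ls) (size ms)) =
    \prod_(m <- ms) \prod_(l <- ls) (l - m).
Proof.
elim: ms => [|m ms IHms]; first by rewrite big_nil det_mx00.
rewrite big_cons -IHms /=; set p := size ls; set q := size ms.
set c := supercoef ls (m :: ms); set c' := supercoef ls ms.
have c0 : vanish_neg c by apply: supercoef_neg.
have cE k : c k + m * c (k - 1) = c' k by apply: supercoef_consr.
pose L : 'M[S]_(1 + q) := \matrix_(i, k)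
  if i == 0 then (linfactors ms)`_k else (i == k)%:R.
pose U : 'M[S]_(1 + q) := \matrix_(k, j) ((k == j)%:R + m * (k.+1 == j)%:R).
have dL : \det L = 1.
  apply: det_unitrig => [i j ji|i]; rewrite mxE; last first.
    by case: eqP => [->|_]; rewrite ?linfactors0 ?eqxx.
  case: eqP => [i0|_]; first by rewrite i0 in ji.
  by case: eqP => // ij; rewrite ij ltnn in ji.
have dU : \det U = 1.
  apply: det_unitrig => [i j ji|i]; rewrite mxE.
    case: eqP => [ij|_]; first by rewrite ij ltnn in ji.
    by case: eqP => [ij|_]; [lia | rewrite mulr0 addr0].
  by rewrite eqxx; case: eqP => [ij|_]; [lia | rewrite mulr0 addr0].
pose T : 'M_(1 + q) := toeplitz c p (1 + q).
have TU (i : 'I_(1 + q)) (j : 'I_q) : (T *m U) i (rshift 1 j) = c' (p%:Z + j%:Z + 1 - i%:Z).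
  rewrite mxE; under eq_bigr => k _ do rewrite mxE [U _ _]mxE mulrDr mulrCA.
  rewrite big_split /= sum_delta -mulr_sumr.
  rewrite -cE; congr (_ + m * _); first by congr c; rewrite /=; lia.
  have hj : (j < 1 + q)%N by have := ltn_ord j; lia.
  rewrite -[RHS](_ : c (p%:Z + (Ordinal hj)%:Z - i%:Z) = _); last by congr c; rewrite /=; lia.
  rewrite -(sum_delta (fun k : 'I_(1 + q) => c (p%:Z + k%:Z - i%:Z)) (Ordinal hj)).
  by apply: eq_bigr => k _; congr (_ * _%:R).
have TU0 (i : 'I_(1 + q)) : (T *m U) i 0 = c (p%:Z - i%:Z).
  rewrite mxE; under eq_bigr => k _ do rewrite mxE [U _ _]mxE mulr0 addr0.
  by rewrite sum_delta; congr c; rewrite /=; lia.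
have -> : \det (toeplitz c p (1 + q)) = \det (L *m (T *m U)).
  by rewrite !det_mulmx dL dU mul1r mulr1.
have -> : L *m (T *m U) = block_mx (\prod_(l <- ls) (l - m))%:M 0
    (dlsubmx (L *m (T *m U))) (toeplitz c' p q).
  rewrite -[LHS]submxK; congr block_mx.
  - apply/matrixP => i j; rewrite !ord1 !mxE eqxx.
    have := @act_div_supercoef S ls ms m c 0 c0 cE; rewrite mul1r => <-.
    apply: eq_bigr => k _; rewrite mxE lshift0 eqxx addn0; congr (_ * _).
    exact: TU0.
  - apply/matrixP => i j; rewrite !ord1 !mxE.
    transitivity (\sum_(k < 1 + q) (linfactors ms)`_k * c' ((p + j.+1)%N%:Z - k%:Z)).
      apply: eq_bigr => k _; rewrite mxE lshift0 eqxx; congr (_ * _).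
      by rewrite TU; congr c'; rewrite /=; lia.
    by rewrite act_linfactors_supercoef supercoef_nilr_gt //; rewrite -/p; lia.
  - apply/matrixP => i j; rewrite !mxE.
    transitivity (\sum_(k < 1 + q) c' (p%:Z + j%:Z + 1 - k%:Z) * (k == rshift 1 i)%:R).
      apply: eq_bigr => k _; rewrite mxE TU mulrC; congr (_ * _).
      by rewrite -(inj_eq val_inj) /= eq_sym.
    by rewrite sum_delta; congr c'; rewrite /=; lia.
by rewrite det_lblock det_scalar1.
Qed.

Definition hankel f (k : int) (q : nat) : 'M[S]_q := \matrix_(i, j) f (k + i%:Z + j%:Z).

Lemma det_antidiagonal n :
  \det (\matrix_(i < n, j < n) ((i + j).+1 == n)%:R : 'M[S]_n) = (-1) ^+ 'C(n, 2).
Proof.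
elim: n => [|n IHn]; first by rewrite det_mx00 expr0.
rewrite (expand_det_row _ 0) (bigD1 ord_max) //= big1 ?addr0 => [|j jn].
  rewrite mxE /= eqxx mul1r /cofactor add0n binS bin1 exprD mulrC -IHn.
  congr (\det _ * _); apply/matrixP => i j; rewrite !mxE /= !/bump /= add1n addSn.
  by rewrite (_ : (n <= j)%N = false) ?add0n //; have := ltn_ord j; lia.
rewrite mxE /= (_ : (_ == _) = false) ?mul0r //.
by apply/negbTE; apply: contra jn => /eqP h; apply/eqP/val_inj => /=; lia.
Qed.

(** Reversing the order of the rows turns the Hankel matrix into the Toeplitz matrix;
    [det_antidiagonal] is the sign of that reversal. *)
Lemma det_hankel f (p q : nat) :
  \det (hankel f (p%:Z - q%:Z + 1) q) = (-1) ^+ 'C(q, 2) * \det (toeplitz f p q).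
Proof.
rewrite -det_antidiagonal -det_mulmx; congr (\det _).
apply/matrixP => i j; rewrite !mxE.
under eq_bigr => k _.
  rewrite mxE mulrC (_ : (_ == _) = (k == rev_ord i)); first over.
  rewrite -(inj_eq val_inj) /=; have := ltn_ord i; have := ltn_ord k => *.
  by apply/eqP/eqP; lia.
by rewrite sum_delta mxE; congr f; have := ltn_ord i; rewrite /=; lia.
Qed.

(** Multiplication by the unitriangular matrix U of the series 1 / R^- turns the rows of R^- into
    unit vectors and the rows of R^+ into shifted coefficients of R^+ / R^-, so that a Toeplitz
    block remains. *)
Lemma det_sylvester ls ms :
  \det (col_mx (\matrix_(i < size ls, j < size ls + size ms) ('X^i * linfactors ms)`_j)
               (\matrix_(i < size ms, j < size ls + size ms) ('X^i * linfactors ls)`_j))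
  = \prod_(m <- ms) \prod_(l <- ls) (l - m).
Proof.
rewrite -det_toeplitz; set p := size ls; set q := size ms.
set M := col_mx _ _; pose u := supercoef [::] ms.
pose U : 'M[S]_(p + q) := \matrix_(j, k) u (k%:Z - j%:Z).
have u0 : vanish_neg u by apply: supercoef_neg.
have dU : \det U = 1.
  apply: det_unitrig => [i j ji|i]; rewrite mxE; first by rewrite vanish_lt0 //; lia.
  by rewrite subrr; apply: supercoef0.
have conv ks i (k : 'I_(p + q)) :
    \sum_(j < p + q) ('X^i * linfactors ks)`_j * u (k%:Z - j%:Z)
    = \sum_(j < (size ks).+1) (linfactors ks)`_j * u (k%:Z - i%:Z - j%:Z).
  have E N (g : nat -> S) : (k < N)%N -> (forall j, (k < j)%N -> g j = 0) ->
     \sum_(j < N) g j = \sum_(j < k.+1) g j.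
    move=> kN g0; rewrite -(big_mkord xpredT g) (big_cat_nat _ (n := k.+1)) //=.
    rewrite big_mkord [X in _ + X]big1_seq ?addr0 // => j.
    by rewrite mem_index_iota => /andP[_ /andP[/g0]].
  (* Terms with j > k vanish, so the range may be enlarged until it contains every coefficient of
     the shifted polynomial. *)
  set s := (size ks).+1; pose N := (p + q + i + s)%N.
  transitivity (\sum_(j < N) ('X^i * linfactors ks)`_j * u (k%:Z - j%:Z)).
    pose g j := ('X^i * linfactors ks)`_j * u (k%:Z - j%:Z).
    have g0 j : (k < j)%N -> g j = 0 by move=> kj; rewrite /g vanish_lt0 ?mulr0 //; lia.
    by rewrite (E _ g) ?[RHS](E _ g) //; have := ltn_ord k; rewrite /N; lia.
  rewrite (_ : N = i + (s + (p + q)))%N; last by rewrite /N; lia.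
  rewrite big_split_ord /= big1 ?add0r => [|j _]; last first.
    by rewrite coefXnM ltn_ord mul0r.
  rewrite big_split_ord /= [X in _ + X]big1 ?addr0 => [|j _]; last first.
    rewrite coefXnM ifF ?nth_default ?mul0r //; last by lia.
    by apply: leq_trans (size_linfactors _) _; lia.
  apply: eq_bigr => j _; rewrite coefXnM ifF; last by lia.
  by congr (_`_ _ * u _); lia.
rewrite -[LHS]mulr1 -dU -det_mulmx.
have -> : M *m U = block_mx 1%:M 0 (dlsubmx (M *m U)) (toeplitz (supercoef ls ms) p q).
  have MUu i k : (M *m U) (lshift q i) k = (k%:Z - i%:Z == 0)%:R.
    rewrite mxE; under eq_bigr => j _ do rewrite col_mxEu mxE [U _ _]mxE.
    by rewrite conv act_linfactors_supercoef.
  rewrite -[LHS]submxK; congr block_mx.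
  - apply/matrixP => i j; rewrite [LHS]mxE [LHS]mxE MUu !mxE -(inj_eq val_inj) /=.
    by congr (nat_of_bool _)%:R; apply/eqP/eqP; lia.
  - apply/matrixP => i j; rewrite [LHS]mxE [LHS]mxE MUu mxE.
    by rewrite /=; case: eqP => //; have := ltn_ord i; lia.
  - apply/matrixP => i j; rewrite !mxE.
    under eq_bigr => k _ do rewrite col_mxEd mxE [U _ _]mxE.
    rewrite conv supercoef_conv; congr (supercoef _ _ _); rewrite /=; lia.
by rewrite det_lblock det1 mul1r.
Qed.

End Determinants.

(** * Cofactors of a singular Hankel matrix *)

Section Cofactors.
Variable S : comNzRingType.
Implicit Types (f g : int -> S) (l m z : S) (ls ms : seq S).

Lemma expand_det_replace_row n (H : 'M[S]_n) i (y : 'I_n -> S) :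
  \det (\matrix_(k, j) if k == i then y j else H k j) = \sum_j y j * cofactor H i j.
Proof.
rewrite (expand_det_row _ i); apply: eq_bigr => j _; rewrite mxE eqxx; congr (_ * (_ * \det _)).
by apply/matrixP => k l; rewrite !mxE eq_sym (negPf (neq_lift _ _)).
Qed.

Lemma det_null n (H : 'M[S]_n) (b : 'cV[S]_n) i : H *m b = 0 -> b i 0 = 1 -> \det H = 0.
Proof.
move=> Hb b1; have := congr1 (mulmx (\adj H)) Hb.
rewrite mulmxA mul_adj_mx mulmx0 mul_scalar_mx => /matrixP/(_ i 0).
by rewrite !mxE b1 mulr1.
Qed.

(** Replace row i of H by y = e_j - b_j e_k, which is orthogonal to b. The new matrix still kills b,
    so its determinant, expanded along row i, is 0. *)
Lemma cofactor_null n (H : 'M[S]_n) (b : 'cV[S]_n) i j k :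
  H *m b = 0 -> b k 0 = 1 -> cofactor H i j = b j 0 * cofactor H i k.
Proof.
move=> Hb b1; have [->|jk] := eqVneq j k; first by rewrite b1 mul1r.
have kj : k != j by rewrite eq_sym.
pose y (l : 'I_n) : S := (l == j)%:R - b j 0 * (l == k)%:R.
have: \det (\matrix_(l, m) if l == i then y m else H l m) = 0.
  apply: (@det_null _ _ b k) => //; apply/matrixP => l o; rewrite ord1 {o} !mxE.
  under eq_bigr => m _ do rewrite mxE.
  have [_|_] := eqVneq l i; last by move/matrixP/(_ l 0): Hb; rewrite !mxE.
  rewrite /y (bigD1 j) // (bigD1 k) //= big1 => [|m /andP[/negPf-> /negPf->]].
    by rewrite !eqxx (negPf jk) (negPf kj) b1 mulr1n !mulr0n; ring.
  by rewrite mulr0 subr0 mul0r.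
rewrite expand_det_replace_row (bigD1 j) // (bigD1 k) //= big1; last first.
  by move=> m /andP[/negPf mj /negPf mk]; rewrite /y mj mk mulr0 subr0 mul0r.
rewrite /y !eqxx (negPf jk) (negPf kj) mulr0 subr0 mul1r mulr1 sub0r mulNr addr0.
by move/eqP; rewrite subr_eq0 => /eqP.
Qed.

(* A null vector b of the symmetric matrix H forces its adjugate to be a multiple
   of b b^T.                                                                  *)
Lemma sum_cofactor_hankel ls ms z w (p := size ls) (q := size ms)
    (c := supercoef ls ms) :
  vanish_neg w -> (forall k, w k + z * w (k - 1) = c k) ->
  \sum_(i < q.+1) \sum_(j < q.+1)
     cofactor (hankel c (p%:Z - q%:Z + 1) q.+1) i j * w (p%:Z - q%:Z + i%:Z + j%:Z)
  = \det (hankel c (p%:Z - q%:Z + 1) q) *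
    (\prod_(l <- ls) (l - z) * \prod_(m <- ms) (m - z)).
Proof.
move=> w0 wE; set H := hankel _ _ q.+1.
(* The coefficients are reversed so that the last entry is 1; the last diagonal cofactor, the
   determinant of the Hankel matrix of size q, then serves as reference. *)
pose b : 'cV[S]_q.+1 := \col_j (linfactors ms)`_(q - j).
have b1 : b ord_max 0 = 1 by rewrite mxE subnn linfactors0.
have sumb f k : \sum_(j < q.+1) b j 0 * f (k%:Z - q%:Z + j%:Z) =
    \sum_(j < q.+1) (linfactors ms)`_j * f (k%:Z - j%:Z).
  rewrite [RHS](reindex_inj rev_ord_inj); apply: eq_bigr => j _.
  by rewrite mxE /= subSS; congr (_ * f _); have := ltn_ord j; lia.
have Hb : H *m b = 0.
  apply/matrixP => i o; rewrite ord1 {o} !mxE.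
  transitivity (\sum_(j < q.+1) b j 0 * c ((p + i).+1%:Z - q%:Z + j%:Z)).
    by apply: eq_bigr => j _; rewrite mxE mulrC; congr (_ * c _); lia.
  by rewrite sumb act_linfactors_supercoef supercoef_nilr_gt //; rewrite -/p; lia.
(* Symmetry lets [cofactor_null] act on the row index as well as on the column index. *)
have Hsym : H^T = H by apply/matrixP => i j; rewrite !mxE; congr c; lia.
have cofE i j : cofactor H i j = b i 0 * b j 0 * \det (hankel c (p%:Z - q%:Z + 1) q).
  rewrite (cofactor_null _ _ Hb b1) -cofactor_tr Hsym (cofactor_null _ _ Hb b1).
  rewrite mulrCA mulrA; congr (_ * _); rewrite /cofactor addnn -signr_odd odd_double mul1r.
  by congr (\det _); apply/matrixP => k l; rewrite !mxE !lift_max.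
transitivity (\sum_(i < q.+1) \det (hankel c (p%:Z - q%:Z + 1) q) *
    (b i 0 * ((- z) ^+ i * \prod_(l <- ls) (l - z)))).
  apply: eq_bigr => i _; rewrite -(act_div_supercoef i w0 wE) -sumb !mulr_sumr.
  apply: eq_bigr => j _; rewrite cofE mulrAC mulrC -!mulrA; congr (_ * (_ * (_ * w _))); lia.
rewrite -mulr_sumr; congr (_ * _).
rewrite -(sum_linfactors_rev ms) mulr_sumr; apply: eq_bigr => i _.
rewrite mxE [LHS]mulrA mulrC; congr (_ * (_ * _)).
Qed.

End Cofactors.

(** * Derivatives of determinants *)

Lemma mderiv_prod (K : comNzRingType) v N (k : 'I_v) (F : 'I_N -> {mpoly K[v]}) :
  mderiv k (\prod_i F i) = \sum_i \prod_j (if j == i then mderiv k (F j) else F j).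
Proof.
elim: N F => [|N IHN] F; first by rewrite !big_ord0 mderivC.
rewrite !big_ord_recl mderivM IHN eqxx mulr_sumr; congr (_ + _).
by apply: eq_bigr => i _; rewrite big_ord_recl /=; congr (_ * _).
Qed.

(** Jacobi's formula, obtained by differentiating one row at a time. *)
Lemma mderiv_det (K : comNzRingType) v N (k : 'I_v) (H : 'M[{mpoly K[v]}]_N) :
  mderiv k (\det H) = \sum_i \sum_j mderiv k (H i j) * cofactor H i j.
Proof.
transitivity (\sum_i \det (\matrix_(l, j) if l == i then mderiv k (H i j) else H l j)).
  rewrite /determinant raddf_sum exchange_big; apply: eq_bigr => s _.
  rewrite -mulr_sumr !mulr_sign.
  have E : mderiv k (\prod_i H i (s i)) =
     \sum_i \prod_j (\matrix_(l, j) (if l == i then mderiv k (H i j) else H l j)) j (s j).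
    rewrite mderiv_prod; apply: eq_bigr => i _; apply: eq_bigr => j _; rewrite mxE.
    by case: eqP => [->|].
  by case: ifP => _; rewrite ?raddfN /= E.
by apply: eq_bigr => i _; rewrite expand_det_replace_row.
Qed.

(** * The universal polynomial at given eigenvalues *)

Section Specialization.
Variables (K : fieldType) (S : comNzRingType) (rho : {rmorphism K -> S}).
Variables (ls ms : seq S) (c : int -> S).
Let p := size ls.
Let q := size ms.
Hypothesis cE : c =1 supercoef ls ms.

Let phi : {rmorphism {mpoly K[nvars p q]} -> S} := mmap rho (fun j => c (j%:Z - q%:Z)).

(** [inord] is faithful only inside its range, whence the two bounds. *)
Lemma cidxE (k : int) : (- q%:Z <= k)%R -> (k <= p%:Z + q%:Z + 1)%R ->
  (cidx p q k)%:Z = k + q%:Z.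
Proof. by move=> ? ?; rewrite /cidx inordK /nvars; lia. Qed.

Lemma phi_cvar (k : int) : (- q%:Z <= k)%R -> (k <= p%:Z + q%:Z + 1)%R ->
  phi (cvar K p q k) = c k.
Proof. by move=> h h'; rewrite /phi /= /cvar mmapX mmap1U cidxE //; congr c; lia. Qed.

(** The variable of index p - q + s + 1 fills exactly the antidiagonal i + j = s of the Hankel
    matrix, so its derivative collects the cofactors found there. *)
Lemma phi_Fder (s : nat) : (s <= 2 * q)%N ->
  phi (Fder K p q (p%:Z - q%:Z + s%:Z + 1)) =
  \sum_(i < q.+1) \sum_(j < q.+1)
     cofactor (hankel c (p%:Z - q%:Z + 1) q.+1) i j * (i + j == s)%N%:R.
Proof.
move=> sq; rewrite /Fder mderiv_det rmorph_sum; apply: eq_bigr => i _ /=.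
rewrite rmorph_sum; apply: eq_bigr => j _ /=; rewrite rmorphM mulrC /=.
have := ltn_ord i; have := ltn_ord j => hj hi; congr (_ * _).
  rewrite -cofactor_map_mx; congr (cofactor _ i j); apply/matrixP => k l; rewrite !mxE.
  by have := ltn_ord k; have := ltn_ord l => *; rewrite /= -/phi phi_cvar //; lia.
rewrite mxE /cvar mderivX mnm1E.
have -> : (cidx p q (p%:Z - q%:Z + 1 + i%:Z + j%:Z) ==
           cidx p q (p%:Z - q%:Z + s%:Z + 1)) = (i + j == s)%N.
  apply/eqP/eqP => [/(congr1 (fun k => (nat_of_ord k)%:Z))|].
    by rewrite !cidxE; lia.
  by move=> <-; congr (cidx p q _); rewrite PoszD; ring.
case: eqP => [h|_]; last by rewrite scale0r rmorph0.
rewrite scale1r (_ : _ - _ = 0)%MM ?mpolyX0 ?rmorph1 //.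
apply/mnmP => k; rewrite mnmBE mnm1E mnm0E mnm1E -h.
set a := cidx _ _ _; set a' := cidx _ _ _; rewrite (_ : a = a') ?subnn //.
by rewrite /a /a'; congr (cidx p q _); rewrite PoszD; ring.
Qed.

(** Up to sign, [Hpoly] is the coefficient of x^r in the characteristic function divided by 1 + z x,
    with z the polynomial variable ['X]. This brings the sum into the form contracted in
    [sum_cofactor_hankel]. *)
Lemma map_Hpoly (r : int) : (r <= p%:Z + q%:Z)%R ->
  (-1) ^+ absz r * map_poly phi (Hpoly K p q r) =
    divseq 'X (fun k => (c k)%:P) r :> {poly S}.
Proof.
case: r => [n|n] hn; last by rewrite rmorph0 mulr0.
rewrite /= rmorphD rmorph_sum /= map_polyXn (reindex_inj rev_ord_inj) /=.
rewrite big_ord_recl /= subSS subn0 subnn cE supercoef0 mulr1 mulrDr.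
congr (_ + _); first by rewrite -exprNn.
rewrite big_add1 /= big_mkord mulr_sumr; apply: eq_bigr => k _ /=.
rewrite linearZ /= map_polyXn rmorphM rmorphXn rmorphN1 -/phi.
have hk := ltn_ord k; rewrite phi_cvar; try lia.
rewrite /bump add1n subSS subKn ?ltn_ord // [in RHS]exprNn -mul_polyC rmorphM rmorphXn rmorphN1.
rewrite (_ : (-1) ^+ n = (-1) ^+ (n - k.+1) * (-1) ^+ k.+1 :> {poly S}); last first.
  by rewrite -exprD subnK.
set e := (-1) ^+ k.+1; set x := 'X^_; set y := _%:P; set d := (-1) ^+ _.
by transitivity (e ^+ 2 * (d * x * y)); [ring | rewrite sqrr_sign mul1r].
Qed.

Lemma map_Ptilde :
  map_poly phi (Ptilde K p q) = \det (hankel c (p%:Z - q%:Z + 1) q) *: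
    (\prod_(l <- ls) (l%:P - 'X) * \prod_(m <- ms) (m%:P - 'X)).
Proof.
(* The contraction takes place over [{poly S}] with z = ['X], so the eigenvalues are first made
   constant polynomials. *)
pose ls' := map polyC ls; pose ms' := map polyC ms.
have supercoefC k : (c k)%:P = supercoef ls' ms' k.
  rewrite cE /supercoef /ls' /ms' {ls' ms'}.
  elim: ms k => [|m ms' IHms] k /=; last first.
    case: k => [n|n] //=; rewrite rmorph_sum; apply: eq_bigr => j _.
    by rewrite rmorphM rmorphXn rmorphN -IHms.
  elim: ls k => [|l ls' IHls] k /=; first exact: rmorph_nat.
  transitivity ((foldr (@mulseq S) (oneseq S) ls' k)%:P
                + l%:P * (foldr (@mulseq S) (oneseq S) ls' (k - 1))%:P).
    by rewrite -rmorphM -rmorphD.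
  by rewrite !IHls.
pose w := divseq 'X (supercoef ls' ms') : int -> {poly S}.
have wE : divseq 'X (fun k => (c k)%:P) =1 w by apply: eq_divseq.
have hankelC n k : hankel (supercoef ls' ms') k n = map_mx polyC (hankel c k n).
  by apply/matrixP => i j; rewrite !mxE supercoefC.
have := @sum_cofactor_hankel _ ls' ms' 'X w (divseq_neg _ _)
  (fun k => divseqE _ _ (supercoef_neg _ _)).
rewrite !size_map !big_map -/p -/q -mul_polyC !hankelC det_map_mx => <-.
pose cof i j := cofactor (hankel c (p%:Z - q%:Z + 1) q.+1) i j.
rewrite /Ptilde rmorph_sum /=.
transitivity (\sum_(s < (2 * q).+1) \sum_(i < q.+1) \sum_(j < q.+1)
   (cof i j)%:P * w (p%:Z - q%:Z + i%:Z + j%:Z) * (i + j == s)%N%:R).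
  apply: eq_bigr => s _.
  set r := p%:Z - q%:Z + s%:Z; cbv zeta.
  have hr : (r <= p%:Z + q%:Z)%R by have := ltn_ord s; rewrite /r; lia.
  rewrite map_polyZ rmorphM rmorphXn rmorphN1.
  rewrite phi_Fder; last by have := ltn_ord s; lia.
  rewrite -mul_polyC rmorphM rmorphXn rmorphN1 mulrAC.
  rewrite (map_Hpoly hr).
  rewrite wE mulrC rmorph_sum mulr_suml; apply: eq_bigr => i _ /=.
  rewrite rmorph_sum mulr_suml; apply: eq_bigr => j _ /=.
  rewrite rmorphM rmorph_nat -/(cof i j) [LHS]mulrAC.
  by rewrite /r; case: eqP => [<-|_]; rewrite ?mulr0 // PoszD addrA.
rewrite exchange_big; apply: eq_bigr => i _; rewrite exchange_big; apply: eq_bigr => j _.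
have hij : (i + j < (2 * q).+1)%N by have := ltn_ord i; have := ltn_ord j; lia.
rewrite cofactor_map_mx -/(cof i j).
rewrite (bigD1 (Ordinal hij)) //= eqxx mulr1 big1 ?addr0 // => s; rewrite -(inj_eq val_inj) /=.
by rewrite eq_sym => /negPf ->; rewrite mulr0.
Qed.

End Specialization.

(** Here p and q are separated from the lengths of the lists, which avoids transporting along
    equalities between types that depend on them. *)
Lemma map_Ptilde_size (K : fieldType) (S : comNzRingType) (rho : {rmorphism K -> S})
    (p q : nat) (ls ms : seq S) (c : int -> S) :
  size ls = p -> size ms = q -> c =1 supercoef ls ms ->
  map_poly (mmap rho (fun j : 'I_(nvars p q) => c (j%:Z - q%:Z))) (Ptilde K p q) =
  ((-1) ^+ 'C(q, 2) * \prod_(m <- ms) \prod_(l <- ls) (l - m)) *: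
    (\prod_(l <- ls) (l%:P - 'X) * \prod_(m <- ms) (m%:P - 'X)).
Proof.
move=> <- <- cE; rewrite (map_Ptilde rho cE) -det_toeplitz det_hankel.
by rewrite /toeplitz; congr ((_ * \det _) *: _); apply/matrixP => i j; rewrite !mxE cE.
Qed.

Lemma size_Hpoly (K : fieldType) p q (r : int) n : (r <= n%:Z)%R ->
  (size (Hpoly K p q r) <= n.+1)%N.
Proof.
case: r => [m|m] rn; last by rewrite size_poly0.
apply: leq_trans (size_polyD _ _) _; rewrite geq_max size_polyXn; apply/andP; split; first by lia.
apply: leq_trans (size_sum _ _ _) _; apply/bigmax_leqP_seq => j _ _.
by apply: leq_trans (size_scale_leq _ _) _; rewrite size_polyXn; lia.
Qed.

Lemma size_Ptilde_leq (K : fieldType) p q : (size (Ptilde K p q) <= (p + q).+1)%N.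
Proof.
apply: leq_trans (size_sum _ _ _) _; apply/bigmax_leqP => s _.
apply: leq_trans (size_scale_leq _ _) _; apply: size_Hpoly.
by have := ltn_ord s; lia.
Qed.

Lemma prod_CsubX (S : comNzRingType) (s : seq S) :
  \prod_(l <- s) (l%:P - 'X) = (-1) ^+ size s *: \prod_(l <- s) ('X - l%:P).
Proof.
elim: s => [|l s IHs]; first by rewrite !big_nil scale1r.
by rewrite !big_cons IHs exprS -!mul_polyC rmorphM rmorphN1 /=; ring.
Qed.

(** With all l equal to 1 and all m equal to 0 the resultant is 1, so this specialization has degree
    exactly p + q; specializing cannot raise the degree. *)
Lemma size_Ptilde (K : fieldType) p q : size (Ptilde K p q) = (p + q).+1.
Proof.
apply/eqP; rewrite eqn_leq size_Ptilde_leq ltnNge; apply/negP => h.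
pose ls : seq K := nseq p 1; pose ms : seq K := nseq q 0.
have ls_p : size ls = p by rewrite size_nseq.
have ms_q : size ms = q by rewrite size_nseq.
have := @map_Ptilde K K idfun ls ms _ (fun k => erefl).
rewrite det_hankel det_toeplitz; case: _ / (esym ls_p) h; case: _ / (esym ms_q) => h.
rewrite -big_cat prod_CsubX scalerA => /(congr1 (size \o polyseq)) /=.
rewrite big1_seq => [|m /andP[_ /nseqP[-> _]]]; last first.
  by rewrite big1_seq // => l /andP[_ /nseqP[-> _]]; rewrite subr0.
rewrite mulr1 -exprD size_scale ?signr_eq0 //.
rewrite size_prod_XsubC size_cat => sE.
suff: ((size ls + size ms).+1 <= size ls + size ms)%N by rewrite ltnn.
by rewrite -sE ls_p ms_q; apply: (leq_trans _ h); apply: size_poly.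
Qed.

(** * Homogeneous elements of a supercommutative algebra *)

Section Parity.
Variables (K : fieldType) (A : algType K) (gr : supercomm_grading A).
Implicit Types (a b c : bool) (x y z : A).
Notation par := (has_parity gr).
Notation tw := (twist gr).

Lemma gproj_parity a x : par a (gproj gr a x).
Proof. by rewrite /has_parity gproj_proj eqxx. Qed.

Lemma gproj_homog a b x : par b x -> gproj gr a x = if a == b then x else 0.
Proof. by move=> xb; rewrite -{1}xb gproj_proj xb. Qed.

Lemma parity0 a : par a 0. Proof. exact: raddf0. Qed.

Lemma parityD a x y : par a x -> par a y -> par a (x + y).
Proof. by rewrite /has_parity raddfD /= => -> ->. Qed.

Lemma parityN a x : par a x -> par a (- x).
Proof. by rewrite /has_parity raddfN /= => ->. Qed.

Lemma parityB a x y : par a x -> par a y -> par a (x - y).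
Proof. by move=> xa ya; apply/parityD/parityN. Qed.

Lemma parityZ a k x : par a x -> par a (k *: x).
Proof. by rewrite /has_parity linearZ /= => ->. Qed.

Lemma parity_sum a (I : Type) (r : seq I) (P : pred I) (F : I -> A) :
  (forall i, P i -> par a (F i)) -> par a (\sum_(i <- r | P i) F i).
Proof. by move=> h; elim/big_ind: _ => //; [apply: parity0 | apply: parityD]. Qed.

Lemma parityM a b c x y : par a x -> par b y -> c = a (+) b -> par c (x * y).
Proof. by move=> xa yb ->; apply: gproj_mul. Qed.

Lemma parity_signM a b x : par a x -> par a ((-1) ^+ b * x).
Proof. by case: b => xa; rewrite ?expr0 ?expr1 ?mul1r ?mulN1r //; apply: parityN. Qed.

(** The grading record does not state that 1 is even. In x * 1 = x with x homogeneous, comparing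
    components shows that the even part of 1 is a right identity, hence equal to 1. *)
Lemma parity1 : par false 1.
Proof.
have h b x : par b x -> x * gproj gr false 1 = x.
  move=> xb; have := gproj_sum gr 1 => /(congr1 (fun y => gproj gr b (x * y))).
  rewrite mulrDr raddfD /= mulr1 xb.
  have x0 : par b (x * gproj gr false 1) by apply: (parityM xb (gproj_parity _ _)); case: b {xb}.
  have x1 : par (~~ b) (x * gproj gr true 1) by apply: (parityM xb (gproj_parity _ _)); case: b {xb x0}.
  by rewrite x0 (gproj_homog _ x1); case: b {xb x0 x1}; rewrite addr0.
have {}h x : x * gproj gr false 1 = x.
  by rewrite -{1}(gproj_sum gr x) mulrDl !(h _ _ (gproj_parity _ _)) gproj_sum.
by have := h 1; rewrite mul1r.
Qed.

Lemma parity_nat n : par false n%:R.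
Proof.
elim: n => [|n IHn]; first exact: parity0.
by rewrite mulrS; apply: parityD; [apply: parity1|].
Qed.

Lemma parity_int (k : int) : par false k%:~R.
Proof. by case: k => n; rewrite ?NegzE ?mulrNz; [|apply: parityN]; apply: parity_nat. Qed.

Lemma parityX x n : par false x -> par false (x ^+ n).
Proof.
by move=> xa; elim: n => [|n IHn]; rewrite ?exprS; [apply: parity1 | apply: parityM xa IHn _].
Qed.

Lemma parity_prod (I : Type) (r : seq I) (P : pred I) (F : I -> A) :
  (forall i, P i -> par false (F i)) -> par false (\prod_(i <- r | P i) F i).
Proof.
by move=> h; elim/big_ind: _ => //; [apply: parity1 | move=> x y xa ya; apply: parityM xa ya _].
Qed.

Lemma twist_is_additive b : additive (tw b).
Proof. by move=> x y; rewrite /twist !raddfB /= mulrDr mulrN opprD addrACA. Qed.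

HB.instance Definition _ b := GRing.isZmodMorphism.Build A A (tw b) (twist_is_additive b).

Lemma twistD b x y : tw b (x + y) = tw b x + tw b y. Proof. exact: raddfD. Qed.
Lemma twistN b x : tw b (- x) = - tw b x. Proof. exact: raddfN. Qed.
Lemma twist0 b : tw b 0 = 0. Proof. exact: raddf0. Qed.
Lemma twist_sum b (I : Type) (r : seq I) (P : pred I) (F : I -> A) :
  tw b (\sum_(i <- r | P i) F i) = \sum_(i <- r | P i) tw b (F i).
Proof. exact: raddf_sum. Qed.

Lemma twist_homog b a x : par a x -> tw b x = (-1) ^+ (b && a) * x.
Proof.
move=> xa; rewrite /twist !(gproj_homog _ xa).
by case: a {xa}; rewrite /= ?andbT ?andbF ?mul1r ?add0r ?mulr0 ?addr0 // expr0 mul1r.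
Qed.

Lemma twist_parity b a x : par a x -> par a (tw b x).
Proof. by move=> xa; rewrite (twist_homog _ xa); apply: parity_signM. Qed.

Lemma twist_even b x : par false x -> tw b x = x.
Proof. by move/twist_homog->; rewrite andbF mul1r. Qed.

Lemma homog_ind (P : A -> Prop) : (forall x y, P x -> P y -> P (x + y)) ->
  (forall a x, par a x -> P x) -> forall x, P x.
Proof. by move=> PD Ph x; rewrite -(gproj_sum gr x); apply: PD; apply/Ph/gproj_parity. Qed.

(** [twist] absorbs the exchange sign, so that only one of the two elements has to be
    homogeneous. *)
Lemma supercomm a x y : par a x -> x * y = tw a y * x.
Proof.
move=> xa; elim/homog_ind: y => [y z yE zE|b y yb]; first by rewrite mulrDr raddfD mulrDl yE zE.
by rewrite (twist_homog _ yb) -mulrA; exact: gproj_supercomm xa yb.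
Qed.

Lemma even_central x y : par false x -> x * y = y * x.
Proof. by move/supercomm->; rewrite /twist expr0 mul1r gproj_sum. Qed.

Lemma twistM b x y : tw b (x * y) = tw b x * tw b y.
Proof.
elim/homog_ind: x => [x z xE zE|a x xa].
  by rewrite mulrDl !raddfD /= xE zE -mulrDl.
elim/homog_ind: y => [y z yE zE|c y yc]; first by rewrite mulrDr !raddfD /= yE zE -mulrDr.
rewrite (twist_homog _ xa) (twist_homog _ yc) (twist_homog _ (parityM xa yc erefl)).
rewrite -[RHS]mulrA (mulrA x) commr_sign -[X in _ = _ * X]mulrA [RHS]mulrA -signr_addb.
by congr (_ ^+ (nat_of_bool _) * _); case: b a c {xa yc} => [] [] [].
Qed.

Lemma twistK b c x : tw b (tw c x) = tw (b (+) c) x.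
Proof.
elim/homog_ind: x => [x z xE zE|a x xa]; first by rewrite (twistD c) (twistD b (tw c x)) xE zE -twistD.
rewrite (twist_homog _ (twist_parity c xa)) !(twist_homog _ xa) mulrA -signr_addb.
by congr (_ ^+ (nat_of_bool _) * _); case: b a c {xa} => [] [] [].
Qed.

Lemma twist1 b : tw b 1 = 1. Proof. exact/twist_even/parity1. Qed.
Lemma twist_nat b n : tw b n%:R = n%:R. Proof. exact/twist_even/parity_nat. Qed.
Lemma twist_false x : tw false x = x.
Proof. by rewrite /twist expr0 mul1r gproj_sum. Qed.

Lemma twist_signM b c x : tw b ((-1) ^+ c * x) = (-1) ^+ c * tw b x.
Proof. by case: c; rewrite ?mulN1r ?expr0 ?mul1r // twistN. Qed.

(** * Homogeneous matrices *)

Definition homog_mx m n (r : 'I_m -> bool) (s : 'I_n -> bool) (M : 'M[A]_(m, n)) :=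
  forall i j, par (r i (+) s j) (M i j).

Lemma homog_mxM m n o r s t (M : 'M[A]_(m, n)) (N : 'M[A]_(n, o)) :
  homog_mx r s M -> homog_mx s t N -> homog_mx r t (M *m N).
Proof.
move=> hM hN i j; rewrite mxE; apply: parity_sum => k _.
by apply: parityM (hM i k) (hN k j) _; rewrite addbA addbK.
Qed.

Lemma homog_mx1 n r : homog_mx r r (1%:M : 'M[A]_n).
Proof.
move=> i j; rewrite mxE; case: eqP => [->|_]; last exact: parity0.
by rewrite addbb; apply: parity1.
Qed.

(** The part of M compatible with the row and column parities. Extracting it commutes with left
    multiplication by homogeneous matrices, so it turns an arbitrary right inverse into a
    homogeneous one. *)
Definition mx_component m n (r : 'I_m -> bool) (s : 'I_n -> bool) (M : 'M[A]_(m, n)) :=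
  \matrix_(i, j) gproj gr (r i (+) s j) (M i j).

Lemma mx_componentP m n r s (M : 'M[A]_(m, n)) : homog_mx r s (mx_component r s M).
Proof. by move=> i j; rewrite mxE; apply: gproj_parity. Qed.

Lemma mx_component_id m n r s (M : 'M[A]_(m, n)) : homog_mx r s M -> mx_component r s M = M.
Proof. by move=> hM; apply/matrixP => i j; rewrite mxE hM. Qed.

Lemma gprojMl a b x y : par a x -> gproj gr b (x * y) = x * gproj gr (a (+) b) y.
Proof.
move=> xa; rewrite -{1}(gproj_sum gr y) mulrDr raddfD /=.
rewrite !(gproj_homog b (parityM xa (gproj_parity _ _) erefl)).
by case: a {xa}; case: b => //=; rewrite ?addr0 ?add0r.
Qed.

Lemma mx_componentM m n o r s t (M : 'M[A]_(m, n)) (N : 'M[A]_(n, o)) :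
  homog_mx r s M -> mx_component r t (M *m N) = M *m mx_component s t N.
Proof.
move=> hM; apply/matrixP => i j; rewrite !mxE raddf_sum /=; apply: eq_bigr => k _.
by rewrite mxE (gprojMl _ _ (hM i k)) addbACA addbb.
Qed.

Lemma homog_right_inverse m n r s (M : 'M[A]_(m, n)) (N : 'M[A]_(n, m)) :
  homog_mx r s M -> M *m N = 1%:M -> M *m mx_component s r N = 1%:M.
Proof. by move=> hM MN; rewrite -(mx_componentM _ _ hM) MN mx_component_id //; apply: homog_mx1. Qed.

Lemma homog_invmx m n r s (M : 'M[A]_(m, n)) (N : 'M[A]_(n, m)) :
  homog_mx r s M -> M *m N = 1%:M -> N *m M = 1%:M -> homog_mx s r N.
Proof.
move=> hM MN NM; rewrite (_ : N = mx_component s r N); first exact: mx_componentP.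
rewrite -[RHS]mul1mx -NM -mulmxA homog_right_inverse // mulmx1 //.
Qed.

(** M_ij and N_ji have the same parity r_i + s_j; exchanging them costs (-1)^(r_i + s_j), which
    trades the weight (-1)^(r_i) for (-1)^(s_j). *)
Lemma supertrace_mulC m n r s (M : 'M[A]_(m, n)) (N : 'M[A]_(n, m)) :
  homog_mx r s M -> homog_mx s r N -> supertrace r (M *m N) = supertrace s (N *m M).
Proof.
move=> hM hN; rewrite /supertrace.
under eq_bigr => i _ do rewrite mxE mulr_sumr.
rewrite exchange_big; apply: eq_bigr => j _; rewrite mxE mulr_sumr; apply: eq_bigr => i _.
rewrite (supercomm _ (hM i j)) (twist_homog _ (hN j i)) !mulrA -signr_addb.
by congr (_ ^+ (nat_of_bool _) * _ * _); case: (r i); case: (s j).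
Qed.

End Parity.

(** * Sums over words and rearrangements of words *)

Section TupleSums.
Variables (V : nmodType) (I : finType).

Lemma sum_tuple0 (F : seq I -> V) : \sum_(w : 0.-tuple I) F w = F [::].
Proof.
rewrite (bigD1 [tuple]) //= big1 ?addr0 // => w /negP[]; exact/eqP/tuple0.
Qed.

Lemma sum_tuple_cat j k m (F : seq I -> V) : (m = j + k)%N ->
  \sum_(w : m.-tuple I) F w = \sum_(u : j.-tuple I) \sum_(v : k.-tuple I) F (u ++ v).
Proof.
move->; rewrite pair_bigA /=.
rewrite (reindex (fun uv : j.-tuple I * k.-tuple I => cat_tuple uv.1 uv.2)) //=.
apply: onW_bij; pose g (w : (j + k).-tuple I) := (tcast (minn_idPl (leq_addr k j)) (take_tuple j w),
  tcast (addKn j k) (drop_tuple j w)).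
exists g => [[u v]|w]; rewrite /g /=.
  congr pair; apply: val_inj; rewrite /= val_tcast /=.
    by rewrite take_size_cat ?size_tuple.
  by rewrite drop_size_cat ?size_tuple.
by apply: val_inj; rewrite /= !val_tcast /= cat_take_drop.
Qed.

Lemma sum_tuple1 (F : seq I -> V) : \sum_(w : 1.-tuple I) F w = \sum_x F [:: x].
Proof.
rewrite (reindex (fun x : I => [tuple x])) //=.
apply: onW_bij; exists (fun w : 1.-tuple I => thead w) => [x|w]; first by [].
by apply: val_inj; case: w => [[|x [|y w]] //= hw].
Qed.

Lemma sum_tupleS k (F : seq I -> V) :
  \sum_(w : k.+1.-tuple I) F w = \sum_x \sum_(w : k.-tuple I) F (x :: w).
Proof.
by rewrite (sum_tuple_cat F (erefl : k.+1 = 1 + k)%N)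
  (sum_tuple1 (fun u => \sum_(v : k.-tuple I) F (u ++ v))).
Qed.

End TupleSums.

Section AdjacentTranspositions.
Variables (T : eqType) (P : seq T -> Prop).
Hypothesis Pswap : forall u x y v, P (u ++ x :: y :: v) -> P (u ++ y :: x :: v).

(** The prefix u is generalized because the head of s, once the tails are matched, is moved letter
    by letter to its place in t. *)
Lemma swap_closed_perm s t : perm_eq s t -> P s -> P t.
Proof.
suff h u : perm_eq s t -> P (u ++ s) -> P (u ++ t) by move=> st; apply: (h [::]).
elim: s t u => [|x s IHs] t u; first by rewrite perm_sym => /perm_nilP ->.
move=> xst; have xt : x \in t by rewrite -(perm_mem xst) mem_head.
case/splitPr: xt xst => v1 v2; rewrite perm_sym -cat1s perm_catCA perm_cons perm_sym => /IHs h.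
rewrite -cat_rcons => /h; rewrite cat_rcons {s h IHs}.
elim: v1 u => [|y v1 IHv1] u //= /Pswap.
by rewrite -cat_rcons => /IHv1; rewrite cat_rcons.
Qed.

End AdjacentTranspositions.

(** * The sign of a word and the standard basis of an exterior power *)

Section Words.
Variables (p q : nat).
Notation I := 'I_(p + q).
Implicit Types (x y z : I) (u v w : seq I).

(* The words sorted for this relation are the nondecreasing ones in which only
   odd letters are repeated.                                                   *)
Definition letter_le x y : bool := (x < y)%N || ((x == y) && ipar x).

(** The factor due to x standing before y: an inversion costs the exchange sign, and a repeated
    letter gives 0 if it is even, since it squares to zero, and 1 if it is odd. *)
Definition letter_sign x y : int :=
  if x == y then (ipar x)%:R else if (x < y)%N then 1 else - (-1) ^+ (ipar x && ipar y).

(* The class of the word w in the exterior algebra is [word_sign w] times the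
   class of the sorted word.                                                  *)
Fixpoint word_sign w : int :=
  if w is x :: w' then (\prod_(y <- w') letter_sign x y) * word_sign w' else 1.

(** The words are split by whether they begin with x. After an odd x the list is kept, so that x may
    recur; hence the inner recursion on the length. *)
Fixpoint basis_words (L : seq I) : nat -> seq (seq I) :=
  if L is x :: L' then
    fix words k := if k is k'.+1 then
      basis_words L' k ++ map (cons x) (if ipar x then words k' else basis_words L' k')
    else [:: [::]]
  else fun k => if k is 0 then [:: [::]] else [::].

Lemma letter_le_trans : transitive letter_le.
Proof.
move=> y x z; rewrite /letter_le => /orP[xy|/andP[/eqP-> hy]] /orP[yz|/andP[/eqP<- hz]].
- by rewrite (ltn_trans xy yz).
- by rewrite xy.
- by rewrite yz.
- by rewrite eqxx hz orbT.
Qed.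

Lemma letter_le_anti : antisymmetric letter_le.
Proof.
move=> x y; rewrite /letter_le => /andP[/orP[xy|/andP[/eqP-> //]] /orP[yx|/andP[/eqP-> //]]].
by have := ltn_trans xy yx; rewrite ltnn.
Qed.

Lemma letter_sign_swap x y : letter_sign y x = - (-1) ^+ (ipar x && ipar y) * letter_sign x y.
Proof.
rewrite /letter_sign eq_sym; case: (eqVneq x y) => [->|xy].
  by case: (ipar y).
case: ltnP => h; case: ltnP => h'.
- by have := ltn_trans h h'; rewrite ltnn.
- by rewrite mulNr mulrN opprK -signr_addb addbb.
- by rewrite mulr1 andbC.
- by case/eqP: xy; apply/val_inj/eqP; rewrite eqn_leq h h'.
Qed.

Lemma word_sign_swap u x y v :
  word_sign (u ++ x :: y :: v) = - (-1) ^+ (ipar x && ipar y) * word_sign (u ++ y :: x :: v).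
Proof.
elim: u => [|z u IHu] /=.
  rewrite !big_cons (letter_sign_swap y x) andbC; ring.
rewrite IHu mulrCA; congr (_ * (_ * _)).
by apply: perm_big; rewrite perm_cat2l -cat1s -[X in perm_eq _ X]cat1s -[y :: v]cat1s -[x :: v]cat1s perm_catCA.
Qed.

Lemma word_sign_sorted w : sorted letter_le w -> word_sign w = 1.
Proof.
elim: w => //= x w IHw xw; rewrite IHw ?(path_sorted xw) // mulr1 big1_seq // => y /andP[_ yw].
have := order_path_min letter_le_trans xw => /allP/(_ y yw).
by rewrite /letter_le /letter_sign => /orP[h|/andP[-> ->]] //; rewrite h; case: eqP => // xy; rewrite xy ltnn in h.
Qed.

Lemma word_sign_repeat u x v : ~~ ipar x -> word_sign (u ++ x :: x :: v) = 0.
Proof.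
move=> hx; elim: u => [|y u IHu] /=; last by rewrite IHu mulr0.
by rewrite big_cons /letter_sign eqxx (negPf hx) !mul0r.
Qed.

(** After sorting, the only words outside the basis are those that the relations kill. *)
Lemma sorted_word w : sorted leq (map val w) -> ~~ sorted letter_le w ->
  exists u x v, w = u ++ x :: x :: v /\ ~~ ipar x.
Proof.
elim: w => // x [|y w] IHw // /andP[xy hw]; rewrite /= negb_and.
have [h /= nw|hxy _] := boolP (letter_le x y); last first.
  move: hxy; rewrite /letter_le negb_or -leqNgt => /andP[yx hx].
  have xyE : x = y by apply/val_inj/eqP; rewrite eqn_leq xy yx.
  by exists [::], x, w; rewrite -xyE; move: hx; rewrite -xyE eqxx.
have [u [z [v [-> hz]]]] := IHw hw nw.
by exists (x :: u), z, v.
Qed.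

Lemma basis_wordsS x L k : basis_words (x :: L) k.+1 =
  basis_words L k.+1 ++ map (cons x) (basis_words (if ipar x then x :: L else L) k).
Proof. by case E: (ipar x); rewrite /= E. Qed.

Lemma basis_words0 L : basis_words L 0 = [:: [::]].
Proof. by case: L. Qed.

Lemma mem_basis_words (L : seq I) k w : sorted ltn (map val L) ->
  (w \in basis_words L k) = [&& size w == k, sorted letter_le w & all (mem L) w].
Proof.
elim: L k w => [|x L IHL] k w; first by case: k w => [|k] [|y w] _; rewrite /= ?inE ?andbF.
move=> xL; have L_sorted := path_sorted xL.
have x_min y : y \in L -> (x < y)%N.
  by move=> yL; have /allP := order_path_min ltn_trans xL; apply; apply: map_f.
have xNL : x \notin L by apply/negP => /x_min; rewrite ltnn.
elim: k w => [|k IHk] w; first by rewrite basis_words0; case: w.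
rewrite basis_wordsS mem_cat IHL //; case: w => [|y w] /=.
  by apply/negbTE/mapP => -[].
rewrite eqSS inE; have [-> {y}|yx] := eqVneq y x.
  rewrite (negPf xNL) !andbF /= mem_map => [|u v []] //.
  transitivity [&& size w == k, sorted letter_le w &
      all [in if ipar x then x :: L else L] w]; first by case: ifP; rewrite ?IHk ?IHL.
  congr (_ && _); apply/andP/andP => [[ws wL]|[xw wL]]; last first.
    rewrite (path_sorted xw); split=> //; apply/allP => y yw.
    have := allP (order_path_min letter_le_trans xw) _ yw.
    have := allP wL _ yw; rewrite /letter_le /= inE => /orP[/eqP->|yL].
      by rewrite ltnn => /andP[_ ->]; rewrite mem_head.
    by move=> _; case: ifP; rewrite // inE yL orbT.
  have xw : all (letter_le x) w.
    apply/allP => y /(allP wL); rewrite /= /letter_le.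
    case: ifP => hx; last by move/x_min->.
    by rewrite inE => /orP[/eqP->|/x_min->]; rewrite ?eqxx ?hx ?orbT.
  rewrite path_min_sorted ?xw // ws; split=> //.
  apply/allP => y /(allP wL) /=; case: ifP => // _; by rewrite inE orbC => ->.
rewrite [X in _ || X](_ : _ = false) ?orbF; last first.
  by apply/negbTE/mapP => -[v _ [yxE _]]; rewrite yxE eqxx in yx.
case sk: (size w == k) => //=; case yw: (path letter_le y w) => //=.
(* A sorted word beginning with a letter y of L cannot contain x, which is smaller than every letter
   of L. *)
case yL: (y \in L) => //=; apply: eq_in_all => z zw; rewrite inE.
have yz := allP (order_path_min letter_le_trans yw) _ zw.
suff zxF : (z == x) = false by rewrite /= inE zxF.
apply/eqP => zx; move: yz; rewrite zx /letter_le (negPf yx) orbF.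
by have := x_min _ yL; lia.
Qed.

Lemma uniq_basis_words (L : seq I) k : sorted ltn (map val L) -> uniq (basis_words L k).
Proof.
elim: L k => [|x L IHL] k; first by case: k.
move=> xL; have L_sorted := path_sorted xL.
have xNL : x \notin L.
  by apply/negP => hx; have /allP/(_ (val x)) := order_path_min ltn_trans xL;
     rewrite map_f // ltnn => /(_ isT).
elim: k => [|k IHk]; first by rewrite basis_words0.
rewrite basis_wordsS cat_uniq IHL // map_inj_uniq; last by move=> u v [].
apply/andP; split=> //; apply/andP; split; last by case: ifP => _; rewrite ?IHk ?IHL.
apply/hasP => -[w /mapP[v _ ->]]; rewrite /= mem_basis_words //.
by rewrite /= (negPf xNL) !andbF.
Qed.

Definition ext_words k : seq (seq I) := basis_words (enum I) k.

Lemma mem_ext_words k w : (w \in ext_words k) = (size w == k) && sorted letter_le w.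
Proof.
rewrite mem_basis_words ?val_enum_ord ?iota_ltn_sorted //.
by rewrite (_ : all _ w) ?andbT //; apply/allP => x _; rewrite /= mem_enum.
Qed.

Lemma uniq_ext_words k : uniq (ext_words k).
Proof. by apply: uniq_basis_words; rewrite val_enum_ord iota_ltn_sorted. Qed.

Lemma perm_ext_words k w w' : w \in ext_words k -> w' \in ext_words k ->
  perm_eq w w' -> w = w'.
Proof.
rewrite !mem_ext_words => /andP[_ ws] /andP[_ ws'].
exact: (sorted_eq letter_le_trans letter_le_anti).
Qed.

End Words.

(** * Exterior powers of a free supermodule *)

Section ExteriorPower.
Variables (K : fieldType) (A : algType K) (gr : supercomm_grading A) (p q : nat).
Hypothesis two_neq0 : 2%:R != 0 :> K.
Notation I := 'I_(p + q).
Notation tensor := (seq I -> A).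
Notation par := (has_parity gr).
Notation tw := (twist gr).
Implicit Types (x y z : I) (u v w : seq I) (t s : tensor) (G : tensor) (k : nat).

Definition swap_sign x y : A := (-1) ^+ (ipar x && ipar y).

(** Through [pairing] such a G is a right-linear functional that vanishes on the relations between
    basis vectors, that is, a functional on the exterior power. *)
Definition alternating G := forall u x y v,
  G (u ++ x :: y :: v) = - swap_sign x y * G (u ++ y :: x :: v).

Definition pairing k G t : A := \sum_(w : k.-tuple I) G w * t w.

Lemma pairing0 G t : pairing 0 G t = G [::] * t [::].
Proof. exact: (sum_tuple0 (fun w => G w * t w)). Qed.

Lemma pairingS k G t :
  pairing k.+1 G t = \sum_x pairing k (fun w => G (x :: w)) (fun w => t (x :: w)).
Proof. exact: (sum_tupleS k (fun w => G w * t w)). Qed.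

Lemma eq_oppr0 (a : A) : a = - a -> a = 0.
Proof.
move=> aN; have a2 : (2%:R : K) *: a = 0 by rewrite scaler_nat mulr2n {1}aN addNr.
by rewrite -[a]scale1r -(mulVf two_neq0) -scalerA a2 scaler0.
Qed.

Lemma wpar_cat u v : wpar (u ++ v) = wpar u (+) wpar v.
Proof. by rewrite /wpar count_cat oddD. Qed.

Lemma wpar_cons x v : wpar (x :: v) = ipar x (+) wpar v.
Proof. by rewrite /wpar /= oddD oddb. Qed.

Lemma wpar_swap u x y v : wpar (u ++ x :: y :: v) = wpar (u ++ y :: x :: v).
Proof. by rewrite !wpar_cat !wpar_cons; congr (_ (+) _); apply: addbCA. Qed.

Lemma alternating_catl u (a : seq I -> A) G :
  (forall x y u' v, a (u' ++ x :: y :: v) = a (u' ++ y :: x :: v)) ->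
  alternating G -> alternating (fun v => G (u ++ v) * a v).
Proof. by move=> aS altG u' x y v /=; rewrite !catA altG -!catA aS mulrA. Qed.

Lemma alternating_catr b v G : alternating G -> alternating (fun u => tw b (G (u ++ v))).
Proof.
move=> altG u x y u'; rewrite /= -!catA /= altG mulNr twistN /swap_sign twist_signM.
by rewrite mulNr.
Qed.

Lemma pairing_tmul k G t s : pairing k G (tmul gr t s) =
  \sum_(j < k.+1) \sum_(u : j.-tuple I) \sum_(v : (k - j).-tuple I)
     G (u ++ v) * (tw (wpar v) (t u) * s v).
Proof.
rewrite /pairing /tmul.
under eq_bigr => w _ do rewrite size_tuple mulr_sumr.
rewrite exchange_big; apply: eq_bigr => j _.
have jk : (j <= k)%N by rewrite -ltnS.
rewrite (sum_tuple_cat (fun w => G w * (tw (wpar (drop j w)) (t (take j w)) * s (drop j w)))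
  (esym (subnKC jk))).
apply: eq_bigr => u _; apply: eq_bigr => v _.
by rewrite take_size_cat ?drop_size_cat ?size_tuple.
Qed.

Lemma tmul_tvec (a : 'cV[A]_(p + q)) t w : tmul gr (tvec a) t w =
  if w is y :: w' then tw (wpar w') (a y 0) * t w' else 0.
Proof.
rewrite /tmul; case: w => [|y w]; first by rewrite big_ord1 twist0 mul0r.
rewrite !big_ord_recl /= twist0 mul0r add0r /bump /= drop0 take0 big1 ?addr0 // => j _.
by case: w j => [|z w] j; [case: j | rewrite /= twist0 mul0r].
Qed.

(** The coefficients of a generator of the ideal are symmetric up to the exchange sign, while an
    alternating functional is antisymmetric up to it. *)
Lemma vhomog_gen_sym (a b : bool) (u v : 'cV[A]_(p + q)) (x y : I) :
  vhomog gr a u -> vhomog gr b v ->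
  let g x y := tw (ipar y) (v x 0) * u y 0 +
               (-1) ^+ (a && b) * (tw (ipar y) (u x 0) * v y 0) in
  g x y = swap_sign x y * g y x.
Proof.
move=> ha hb /=; rewrite !(twist_homog _ (ha _)) !(twist_homog _ (hb _)) /swap_sign.
rewrite -!mulrA !mulrDr.
rewrite [u y 0 * v x 0](supercomm _ (ha y)) (twist_homog _ (hb x)).
rewrite [v y 0 * u x 0](supercomm _ (hb y)) (twist_homog _ (ha x)).
rewrite [RHS]addrC !mulrA -!signr_addb.
by congr (_ ^+ (nat_of_bool _) * _ * _ + _ ^+ (nat_of_bool _) * _ * _);
  case: a {ha}; case: b {hb}; case: (ipar x); case: (ipar y).
Qed.

(** A generator lives in degree 2. For a product, freezing the letters that belong to the other
    factor leaves an alternating functional, to which the induction hypothesis applies. *)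
Lemma pairing_ideal t : ext_ideal gr t -> forall k G, alternating G -> pairing k G t = 0.
Proof.
elim=> {t} [a b u v ha hb|//|t s _ IHt _ IHs|x t _ _ IHt|t x _ _ IHt] k G altG.
- pose g x y := tw (ipar y) (v x 0) * u y 0 +
                (-1) ^+ (a && b) * (tw (ipar y) (u x 0) * v y 0).
  have wp1 y : wpar [:: y] = ipar y by rewrite wpar_cons addbF.
  case: k => [|[|[|k]]].
  + by rewrite pairing0 !tmul_tvec mulr0 addr0 mulr0.
  + rewrite pairingS big1 // => x _.
    by rewrite pairing0 !tmul_tvec /= !mulr0 addr0 mulr0.
  + transitivity (\sum_x \sum_y G [:: x; y] * g x y).
      rewrite pairingS; apply: eq_bigr => x _; rewrite pairingS; apply: eq_bigr => y _.
      by rewrite pairing0 !tmul_tvec /= wp1.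
    (* Exchanging x and y shows that the sum is its own opposite, hence 0 as 2 is invertible. *)
    apply: eq_oppr0; rewrite {2}exchange_big /= -sumrN; apply: eq_bigr => x _.
    rewrite -sumrN; apply: eq_bigr => y _.
    rewrite (altG [::] x y [::]) /g (vhomog_gen_sym x y ha hb) -/(g y x) !mulNr; congr (- _).
    by rewrite /swap_sign -(commr_sign (G _)) -mulrA [X in _ * X]mulrA -signr_addb addbb expr0 mul1r.
  + rewrite pairingS big1 // => x _; rewrite pairingS big1 // => y _.
    rewrite pairingS big1 // => z _; rewrite /pairing big1 // => w _.
    by rewrite !tmul_tvec /= !mulr0 addr0 mulr0.
- by rewrite /pairing big1 // => w _; rewrite mulr0.
- rewrite -[RHS](addr0 0) -{1}(IHt k G altG) -(IHs k G altG) /pairing -big_split /=.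
  by apply: eq_bigr => w _; rewrite mulrDr.
- rewrite pairing_tmul big1 // => j _; rewrite big1 // => u _.
  rewrite -[RHS](IHt (k - j)%N _ (@alternating_catl u (fun v => tw (wpar v) (x u)) G _ altG)).
    by apply: eq_bigr => v _; rewrite mulrA.
  by move=> y z u' v; rewrite wpar_swap.
- rewrite pairing_tmul big1 // => j _; rewrite exchange_big big1 // => v _ /=.
  (* The twist is an involutive ring morphism: twisting G beforehand lets it be pulled out of the
     whole pairing with t. *)
  transitivity (tw (wpar v) (pairing j (fun u => tw (wpar v) (G (u ++ v))) t) * x v); last first.
    by rewrite IHt ?twist0 ?mul0r //; apply: alternating_catr.
  rewrite /pairing twist_sum mulr_suml.
  by apply: eq_bigr => u _; rewrite twistM twistK addbb twist_false mulrA.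
Qed.

Definition word_tensor w : tensor := fun w' => (w' == w)%:R.

Lemma tmul_word_tensor u v : tmul gr (word_tensor u) (word_tensor v) = word_tensor (u ++ v).
Proof.
apply/funext => w; rewrite /tmul /word_tensor.
under eq_bigr => j _ do rewrite twist_nat -natrM mulnb.
have [->|wuv] := eqVneq w (u ++ v).
  have hu : (size u < (size (u ++ v)).+1)%N by rewrite size_cat ltnS leq_addr.
  rewrite (bigD1 (Ordinal hu)) //= take_size_cat // drop_size_cat // !eqxx big1 ?addr0 //.
  move=> j ju; case: eqP => //= tu; case/negP: ju; apply/eqP/val_inj => /=.
  by rewrite -{2}tu size_takel // -ltnS.
rewrite big1 // => j _; case: andP => // -[/eqP tu /eqP dv].
by case/eqP: wuv; rewrite -(cat_take_drop j w) tu dv.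
Qed.

Lemma word_tensor_tvec x : word_tensor [:: x] = tvec (delta_mx x 0 : 'cV_(p + q)).
Proof.
apply/funext => -[|y [|z w]]; rewrite /word_tensor /tvec //.
  by rewrite mxE eqxx andbT eqseq_cons andbT.
by rewrite eqseq_cons andbF.
Qed.

Lemma tfinite_word_tensor w : tfinite (word_tensor w).
Proof.
exists (size w) => w' h; rewrite /word_tensor; case: eqP => // h'.
by rewrite h' ltnn in h.
Qed.

Lemma vhomog_delta x : vhomog gr (ipar x) (delta_mx x 0 : 'cV_(p + q)).
Proof.
move=> y; rewrite mxE andbT; case: eqP => [->|_]; last exact: parity0.
by rewrite addbb; apply: parity1.
Qed.

Lemma ideal_swap u x y v : ext_ideal gr
  (fun w => word_tensor (u ++ x :: y :: v) w + swap_sign x y * word_tensor (u ++ y :: x :: v) w).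
Proof.
have h := ext_ideal_gen (vhomog_delta y) (vhomog_delta x).
have {}h := ext_idealMl (tfinite_word_tensor u) (ext_idealMr (tfinite_word_tensor v) h).
congr (ext_ideal gr _): h; rewrite -!word_tensor_tvec !tmul_word_tensor.
have tmulDl t1 t2 t (c : bool) : tmul gr (fun w => t1 w + (-1) ^+ c * t2 w) t =
    fun w => tmul gr t1 t w + (-1) ^+ c * tmul gr t2 t w.
  apply/funext => w; rewrite /tmul mulr_sumr -big_split; apply: eq_bigr => j _ /=.
  by rewrite twistD twist_signM mulrDl mulrA.
have tmulDr t1 t2 t (c : bool) : tmul gr t (fun w => t1 w + (-1) ^+ c * t2 w) =
    fun w => tmul gr t t1 w + (-1) ^+ c * tmul gr t t2 w.
  apply/funext => w; rewrite /tmul mulr_sumr -big_split; apply: eq_bigr => j _ /=.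
  by rewrite mulrDr !mulrA commr_sign.
by rewrite tmulDl tmulDr !tmul_word_tensor andbC -!catA.
Qed.

End ExteriorPower.

(** * Sorted words span the exterior power *)

Section ExteriorBasis.
Variables (K : fieldType) (A : algType K) (gr : supercomm_grading A) (p q : nat).
Hypothesis two_neq0 : 2%:R != 0 :> K.
Notation I := 'I_(p + q).
Notation tensor := (seq I -> A).
Notation par := (has_parity gr).
Notation tw := (twist gr).
Implicit Types (x y z : I) (u v w : seq I) (t s : tensor) (G : tensor) (k : nat).

Notation wtensor := (@word_tensor K A p q).

(** The functional dual to the basis word w0; a word with adjacent equal even letters gets 0 through
    [word_sign]. *)
Definition ext_coord w0 : tensor := fun w => (perm_eq w w0)%:R * (word_sign w)%:~R.

Lemma perm_swap u x y v : perm_eq (u ++ x :: y :: v) (u ++ y :: x :: v).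
Proof. by rewrite perm_cat2l; apply/permPl/(perm_catCA [:: x] [:: y]). Qed.

Lemma ext_coord_alternating w0 : alternating (ext_coord w0).
Proof.
move=> u x y v; rewrite /ext_coord word_sign_swap rmorphM rmorphN rmorph_sign /=.
rewrite (permPl (perm_swap u x y v)) -/(swap_sign A x y) !mulrA; congr (_ * _).
by rewrite mulrN mulNr commr_sign.
Qed.

Lemma sum_word_tensor k t w : size w = k ->
  \sum_(u : k.-tuple I) wtensor u w * t u = t w.
Proof.
move=> wk; rewrite (bigD1 (tcast wk (in_tuple w))) //= val_tcast /word_tensor.
rewrite eqxx mul1r big1 ?addr0 // => w' /negPf w'w.
rewrite (_ : _ == _ = false) ?mul0r //; apply/negbTE; apply: contraFN w'w => /eqP w'E.
by apply/eqP/val_inj; rewrite /= val_tcast.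
Qed.

Lemma pairing_word_tensor k G w : size w = k -> pairing k G (wtensor w) = G w.
Proof.
move=> wk; rewrite /pairing -[RHS](sum_word_tensor _ wk).
apply: eq_bigr => u _; rewrite /word_tensor eq_sym.
by case: eqP; rewrite ?mulr0 ?mul0r ?mulr1 ?mul1r.
Qed.

Lemma pairing_sum k G (J : Type) (r : seq J) (F : J -> tensor) (c : J -> A) :
  pairing k G (fun w => \sum_(j <- r) F j w * c j) = \sum_(j <- r) pairing k G (F j) * c j.
Proof.
rewrite /pairing; under eq_bigr => w _ do rewrite mulr_sumr.
rewrite exchange_big; apply: eq_bigr => j _ /=; rewrite mulr_suml.
by apply: eq_bigr => w _; rewrite mulrA.
Qed.

Lemma pairingB k G t s : pairing k G (fun w => t w - s w) = pairing k G t - pairing k G s.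
Proof. by rewrite /pairing -sumrB; apply: eq_bigr => w _; rewrite mulrBr. Qed.

Lemma ext_coord_word k w0 w : w0 \in ext_words p q k -> w \in ext_words p q k ->
  ext_coord w0 w = (w0 == w)%:R.
Proof.
move=> h0 h; rewrite /ext_coord word_sign_sorted; last by move: h; rewrite mem_ext_words => /andP[].
rewrite mulr1; congr (nat_of_bool _)%:R; apply/idP/eqP => [/(perm_ext_words h h0)->|->] //.
Qed.

Lemma sum_uniq_delta (T : eqType) (V : pzSemiRingType) (r : seq T) (F : T -> V) a :
  uniq r -> a \in r -> \sum_(b <- r) F b * (b == a)%:R = F a.
Proof.
move=> ur ar; rewrite (bigD1_seq a) //= eqxx mulr1 big1 ?addr0 // => b /negPf->.
by rewrite mulr0.
Qed.

Section Span.
Variable J : tensor -> Prop.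
Hypothesis J0 : J (fun=> 0).
Hypothesis JD : forall t s, J t -> J s -> J (fun w => t w + s w).
Hypothesis JZ : forall t a, J t -> J (fun w => t w * a).
Hypothesis Jswap : forall u x y v,
  J (fun w => wtensor (u ++ x :: y :: v) w + swap_sign A x y * wtensor (u ++ y :: x :: v) w).

Lemma span_sum (T : Type) (r : seq T) (F : T -> tensor) :
  (forall j, J (F j)) -> J (fun w => \sum_(j <- r) F j w).
Proof.
move=> JF; elim: r => [|j r IHr]; first by under [X in J X]eq_fun => w do rewrite big_nil.
by under [X in J X]eq_fun => w do rewrite big_cons; apply: JD.
Qed.

Let remainder k (e : tensor) t : tensor :=
  fun w => t w - \sum_(w0 <- ext_words p q k) wtensor w0 w * e w0.

(** A word and its coordinates change by the same sign under an adjacent swap, so it suffices to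
    treat the sorted rearrangement. J is abstract because it will be the ideal in one use and the
    kernel of an alternating functional in another. *)
Lemma span_word k w : size w = k -> J (remainder k (ext_coord^~ w) (wtensor w)).
Proof.
pose P w := size w = k -> J (remainder k (ext_coord^~ w) (wtensor w)).
suff: P w by [].
pose s := sort (fun x y : I => x <= y)%N w.
have sw : perm_eq s w by rewrite perm_sort.
apply: (@swap_closed_perm _ P _ s w sw) => [u x y v Puxyv|]; rewrite /P.
  move=> hk; have {}/Puxyv Jx : size (u ++ x :: y :: v) = k by rewrite -hk !size_cat.
  have := JD (Jswap u y x v) (JZ (- swap_sign A x y) Jx).
  congr J; apply/funext => w'; rewrite /remainder /=.
  have -> : \sum_(w0 <- ext_words p q k) wtensor w0 w' * ext_coord w0 (u ++ y :: x :: v) =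
      - ((\sum_(w0 <- ext_words p q k) wtensor w0 w' * ext_coord w0 (u ++ x :: y :: v)) *
         swap_sign A x y).
    rewrite mulr_suml -sumrN; apply: eq_bigr => w0 _.
    rewrite (ext_coord_alternating w0 u y x v) /swap_sign (andbC (ipar y)) mulNr mulrN.
    by rewrite -mulrA commr_sign.
  rewrite opprK mulrN mulrBl opprB -addrA; congr (_ + _).
  by rewrite /swap_sign (andbC (ipar y)) -(commr_sign (wtensor (u ++ x :: y :: v) w')) addrC subrK.
move=> sk; have [hs|/sorted_word hs] := boolP (sorted (@letter_le p q) s).
  have hw : s \in ext_words p q k by rewrite mem_ext_words sk eqxx.
  rewrite (_ : remainder _ _ _ = fun=> 0) //; apply/funext => w'; rewrite /remainder.
  rewrite big_seq; under eq_bigr => w0 h0 do rewrite (ext_coord_word h0 hw).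
  by rewrite -big_seq sum_uniq_delta ?uniq_ext_words ?subrr.
have /hs [u [x [v [sE xe]]]] : sorted leq (map val s).
  by rewrite sorted_map; apply: sort_sorted => x y; apply: leq_total.
rewrite sE (_ : remainder _ _ _ = wtensor (u ++ x :: x :: v)); last first.
  apply/funext => w'; rewrite /remainder big1 ?subr0 // => w0 _.
  by rewrite /ext_coord word_sign_repeat // !mulr0.
(* Swapping two equal even letters puts twice the word in J; halve it. *)
have := JZ (2%:R^-1)%:A (Jswap u x x v); congr J; apply/funext => w'.
rewrite /swap_sign (negPf xe) expr0 mul1r -mulr2n -scaler_nat.
by rewrite mulr_algr scalerA mulVf ?scale1r.
Qed.

Lemma span_tensor k t : tdegree k t ->
  J (remainder k (fun w0 => pairing k (ext_coord w0) t) t).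
Proof.
move=> tk.
have := @span_sum (k.-tuple I) (index_enum _)
  (fun (u : k.-tuple I) w => remainder k (ext_coord^~ u) (wtensor u) w * t u)
  (fun u : k.-tuple I => JZ _ (span_word (size_tuple u))).
congr J; apply/funext => w; rewrite /remainder /=.
under eq_bigr => u _ do rewrite mulrBl mulr_suml.
rewrite sumrB exchange_big /=; congr (_ - _).
  have [wk|wk] := eqVneq (size w) k; last first.
    rewrite tk // big1 // => u _; rewrite /word_tensor (_ : _ == _ = false) ?mul0r //.
    by apply/negbTE/eqP => wu; rewrite wu size_tuple eqxx in wk.
  exact: sum_word_tensor.
apply: eq_bigr => w0 _; rewrite mulr_sumr; apply: eq_bigr => u _.
by rewrite mulrA.
Qed.

End Span.
End ExteriorBasis.

(** * Coordinates and the induced operator on an exterior power *)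

Section ExteriorTrace.
Variables (K : fieldType) (A : algType K) (gr : supercomm_grading A) (p q : nat).
Hypothesis two_neq0 : 2%:R != 0 :> K.
Notation I := 'I_(p + q).
Notation tensor := (seq I -> A).
Notation par := (has_parity gr).
Notation tw := (twist gr).
Implicit Types (x y z : I) (u v w : seq I) (t s : tensor) (G : tensor) (k : nat).
Implicit Types (M N C : 'M[A]_(p + q)).

Notation wtensor := (@word_tensor K A p q).
Notation ecoord := (@ext_coord K A p q).

Lemma ideal_scale t a : ext_ideal gr t -> ext_ideal gr (fun w => t w * a).
Proof.
move=> tI; pose s : tensor := fun w => if w is [::] then a else 0.
have sf : tfinite s by exists 0%N => -[].
have := ext_idealMr sf tI; congr (ext_ideal gr _); apply/funext => w; rewrite /tmul.
rewrite big_ord_recr /= drop_size take_size twist_false big1 ?add0r // => j _.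
rewrite [X in _ * X](_ : _ = 0) ?mulr0 // /s; case E: (drop j w) => //.
by have := size_drop j w; rewrite E /=; have := ltn_ord j; lia.
Qed.

Lemma ideal_span k t : tdegree k t ->
  ext_ideal gr (fun w => t w - \sum_(w0 <- ext_words p q k) wtensor w0 w * pairing k (ecoord w0) t).
Proof.
apply: (span_tensor two_neq0); [exact: ext_ideal0|exact: ext_idealD|exact: ideal_scale|].
exact: ideal_swap.
Qed.

(** The span argument is applied to J, the kernel of the pairing with G, rather than to the
    ideal. *)
Lemma alternating_expand k G t : alternating G -> tdegree k t ->
  pairing k G t = \sum_(w0 <- ext_words p q k) G w0 * pairing k (ecoord w0) t.
Proof.
move=> altG tk; pose J t := pairing k G t = 0.
have J0 : J (fun=> 0) by rewrite /J /pairing big1 // => w _; rewrite mulr0.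
have JD t1 t2 : J t1 -> J t2 -> J (fun w => t1 w + t2 w).
  rewrite /J /pairing => h1 h2; under eq_bigr => w _ do rewrite mulrDr.
  by rewrite big_split /= h1 h2 addr0.
have JZ t1 a : J t1 -> J (fun w => t1 w * a).
  rewrite /J /pairing => h1; under eq_bigr => w _ do rewrite mulrA.
  by rewrite -mulr_suml h1 mul0r.
have Jswap u x y v : J (fun w =>
    wtensor (u ++ x :: y :: v) w + swap_sign A x y * wtensor (u ++ y :: x :: v) w).
  exact: pairing_ideal two_neq0 _ (ideal_swap gr u x y v) _ _ altG.
have := span_tensor two_neq0 J0 JD JZ Jswap tk.
rewrite /J pairingB pairing_sum => /eqP; rewrite subr_eq0 => /eqP ->.
rewrite big_seq [RHS]big_seq; apply: eq_bigr => w0.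
by rewrite mem_ext_words => /andP[/eqP w0k _]; rewrite pairing_word_tensor.
Qed.

(** Entry (w, u) of the tensor power of M. Each entry of M is twisted because it moves past the
    basis vectors of the rest of w. *)
Fixpoint tensor_coef M w u : A :=
  match w, u with
  | [::], [::] => 1
  | y :: w', x :: u' => tw (wpar w') (M y x) * tensor_coef M w' u'
  | _, _ => 0
  end.

Lemma tensor_coefE M w u :
  foldr (fun j => tmul gr (tvec (col j M))) (tone A (q := q)) u w = tensor_coef M w u.
Proof.
elim: u w => [|x u IHu] [|y w] //=; rewrite tmul_tvec //.
by rewrite mxE IHu.
Qed.

Lemma tensor_mapE M t w : tensor_map gr M t w = \sum_(u : (size w).-tuple I) tensor_coef M w u * t u.
Proof. by apply: eq_bigr => u _; rewrite tensor_coefE. Qed.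

Lemma tensor_coef_cat M w1 w2 u1 u2 : size w1 = size u1 ->
  tensor_coef M (w1 ++ w2) (u1 ++ u2) = tw (wpar w2) (tensor_coef M w1 u1) * tensor_coef M w2 u2.
Proof.
elim: w1 u1 => [|y w1 IHw] [|x u1] //=; first by rewrite twist1 mul1r.
by case=> /IHw ->; rewrite twistM twistK wpar_cat addbC mulrA.
Qed.

Lemma tensor_coef_homog M w u : even_mx gr M -> par (wpar w (+) wpar u) (tensor_coef M w u).
Proof.
move=> hM; elim: w u => [|y w IHw] [|x u]; try exact: parity0; first exact: parity1.
rewrite !wpar_cons; apply: parityM (twist_parity _ (hM y x)) (IHw u) _.
by rewrite addbACA.
Qed.

Lemma tensor_coef_swap M (a b : I) x y w u : even_mx gr M ->
  tensor_coef M [:: a, b & w] [:: x, y & u] =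
  swap_sign A a b * swap_sign A x y * tensor_coef M [:: b, a & w] [:: y, x & u].
Proof.
move=> hM; rewrite /= !wpar_cons !(twist_homog _ (hM _ _)) /swap_sign !mulrA.
congr (_ * _); rewrite -!mulrA [M a x * _]mulrA commr_sign -!mulrA.
rewrite [M b y * _]mulrA commr_sign -!mulrA.
rewrite [M b y * M a x](supercomm _ (hM b y)) (twist_homog _ (hM a x)).
rewrite !mulrA -!signr_addb; congr (_ ^+ (nat_of_bool _) * _ * _).
by case: (ipar a); case: (ipar b); case: (ipar x); case: (ipar y); case: (wpar w).
Qed.

Definition dual_map M G : tensor := fun u =>
  \sum_(w : (size u).-tuple I) G w * tensor_coef M w u.

Lemma pairing_tensor_map k M G t : pairing k G (tensor_map gr M t) = pairing k (dual_map M G) t.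
Proof.
rewrite /pairing; under eq_bigr => w _ do rewrite tensor_mapE size_tuple mulr_sumr.
rewrite exchange_big; apply: eq_bigr => u _ /=; rewrite /dual_map size_tuple mulr_suml.
by apply: eq_bigr => w _; rewrite mulrA.
Qed.

Lemma dual_map_swapE M G u x y v : dual_map M G (u ++ x :: y :: v) =
  \sum_(w1 : (size u).-tuple I) \sum_a \sum_b \sum_(w2 : (size v).-tuple I)
    G (w1 ++ a :: b :: w2) * tensor_coef M (w1 ++ a :: b :: w2) (u ++ x :: y :: v).
Proof.
rewrite /dual_map (sum_tuple_cat (fun w => G w * tensor_coef M w _) (size_cat _ _)).
apply: eq_bigr => w1 _ /=.
rewrite (sum_tupleS _ (fun w => G (w1 ++ w) * tensor_coef M (w1 ++ w) _)).
apply: eq_bigr => a _.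
by rewrite (sum_tupleS _ (fun w => G (w1 ++ a :: w) * tensor_coef M (w1 ++ a :: w) _)).
Qed.

(** A simultaneous swap in rows and columns changes [tensor_coef] by both exchange signs; the one
    for the rows cancels against that of G. Hence the action of M on words descends to the exterior
    power. *)
Lemma alternating_dual_map M G : even_mx gr M -> alternating G -> alternating (dual_map M G).
Proof.
move=> hM altG u x y v; rewrite !dual_map_swapE mulr_sumr; apply: eq_bigr => w1 _.
rewrite mulr_sumr exchange_big; apply: eq_bigr => a _ /=.
rewrite mulr_sumr; apply: eq_bigr => b _; rewrite mulr_sumr; apply: eq_bigr => w2 _.
rewrite !tensor_coef_cat ?size_tuple // tensor_coef_swap // altG.
have -> : wpar [:: b, a & w2] = wpar [:: a, b & w2] by apply: (wpar_swap [::]).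
rewrite /swap_sign (andbC (ipar b)).
set T := tw _ _; set g := G _; set r := tensor_coef _ _ _.
rewrite !mulNr -signr_addb; congr (- _).
rewrite (mulrA T) commr_sign -(mulrA _ T) -(mulrA _ g) (mulrA g) commr_sign -(mulrA _ g).
rewrite mulrA -signr_addb; congr (_ ^+ (nat_of_bool _) * _).
by case: (ipar a && _); case: (ipar x && _).
Qed.

Lemma big_ext_words (V : nmodType) k (F : seq I -> V) :
  \sum_(w <- ext_words p q k) F w = \sum_(i < size (ext_words p q k)) F (nth [::] (ext_words p q k) i).
Proof. by rewrite (big_nth [::]) big_mkord. Qed.

Definition ext_word k (i : 'I_(size (ext_words p q k))) : seq I := nth [::] (ext_words p q k) i.
Definition ext_par k (i : 'I_(size (ext_words p q k))) : bool := wpar (ext_word i).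

Lemma mem_ext_word k (i : 'I_(size (ext_words p q k))) : ext_word i \in ext_words p q k.
Proof. exact: mem_nth. Qed.

Lemma size_ext_word k (i : 'I_(size (ext_words p q k))) : size (ext_word i) = k.
Proof. by have := mem_ext_word i; rewrite mem_ext_words => /andP[/eqP]. Qed.

Lemma ext_word_inj k : injective (@ext_word k).
Proof. by move=> i j /eqP; rewrite nth_uniq ?uniq_ext_words // => /eqP/val_inj. Qed.

Lemma ext_coordE k (i j : 'I_(size (ext_words p q k))) :
  ecoord (ext_word i) (ext_word j) = (i == j)%:R.
Proof. by rewrite (@ext_coord_word _ _ _ _ k) ?mem_ext_word // (inj_eq (@ext_word_inj k)). Qed.

Lemma tdegree_word_tensor k w : size w = k -> tdegree k (wtensor w).
Proof. by move=> wk w' h; rewrite /word_tensor; case: eqP => // w'E; rewrite w'E wk eqxx in h. Qed.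

Lemma tdegree_tensor_map k M t : tdegree k t -> tdegree k (tensor_map gr M t).
Proof.
move=> tk w wk; rewrite tensor_mapE big1 // => u _; rewrite tk ?mulr0 //.
by rewrite size_tuple.
Qed.

Definition ext_mx k M : 'M[A]_(size (ext_words p q k)) :=
  \matrix_(i, j) dual_map M (ecoord (ext_word i)) (ext_word j).

Definition coords k t : 'cV[A]_(size (ext_words p q k)) :=
  \col_i pairing k (ecoord (ext_word i)) t.

Lemma coords_tensor_map k M t : even_mx gr M -> tdegree k t ->
  coords k (tensor_map gr M t) = ext_mx k M *m coords k t.
Proof.
move=> hM tk; apply/matrixP => i o; rewrite !mxE pairing_tensor_map.
rewrite (alternating_expand (alternating_dual_map hM (@ext_coord_alternating K A p q _)) tk).
by rewrite big_ext_words; apply: eq_bigr => j _; rewrite !mxE.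
Qed.

Lemma coords_ideal k t : ext_ideal gr t -> coords k t = 0.
Proof.
move=> tI; apply/matrixP => i o; rewrite !mxE.
exact: (pairing_ideal two_neq0 tI _ (@ext_coord_alternating K A p q _)).
Qed.

Lemma coordsB k t s : coords k (fun w => t w - s w) = coords k t - coords k s.
Proof. by apply/matrixP => i o; rewrite !mxE pairingB. Qed.

Lemma coords_tcomb k m (b : 'I_m -> tensor) (x : 'I_m -> A) :
  coords k (tcomb b x) = \matrix_(i, j) (coords k (b j)) i 0 *m \col_j x j.
Proof.
apply/matrixP => i o; rewrite !mxE pairing_sum; apply: eq_bigr => j _.
by rewrite !mxE.
Qed.

(** The converse of [coords_ideal]: in degree k the coordinates decide membership in the ideal, in
    place of computing in a quotient. *)
Lemma coords_eq0_ideal k t : tdegree k t -> coords k t = 0 -> ext_ideal gr t.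
Proof.
move=> tk t0; have := ideal_span tk; congr (ext_ideal gr _); apply/funext => w.
rewrite big_ext_words big1 ?subr0 // => i _.
by have /matrixP/(_ i 0) := t0; rewrite !mxE => ->; rewrite mulr0.
Qed.

Lemma eq_coords_ideal k t s : tdegree k t -> tdegree k s -> coords k t = coords k s ->
  ext_ideal gr (fun w => t w - s w).
Proof.
move=> tk sk ts; apply: (@coords_eq0_ideal k); last by rewrite coordsB ts subrr.
by move=> w wk; rewrite tk ?sk ?subrr.
Qed.

Lemma parity_ext_coord w0 w : par false (ecoord w0 w).
Proof. exact: parityM (parity_nat _ _) (parity_int _ _) _. Qed.

Lemma ext_coord_wpar w0 w : wpar w0 != wpar w -> ecoord w0 w = 0.
Proof.
move=> h; rewrite /ext_coord (_ : perm_eq w w0 = false) ?mul0r //.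
by apply: contraNF h => /seq.permP hw; rewrite /wpar hw.
Qed.

Lemma parity_pairing k w0 t (a : bool) : thomog gr a t ->
  par (wpar w0 (+) a) (pairing k (ecoord w0) t).
Proof.
move=> ta; apply: parity_sum => w _; have [h|h] := eqVneq (wpar w0) (wpar w).
  by apply: parityM (parity_ext_coord _ _) (ta w) _; rewrite h addbC.
by rewrite ext_coord_wpar // mul0r; apply: parity0.
Qed.

Lemma ext_mx_homog k M : even_mx gr M -> homog_mx gr (@ext_par k) (@ext_par k) (ext_mx k M).
Proof.
move=> hM i j; rewrite mxE; apply: parity_sum => w _.
have [h|h] := eqVneq (wpar (ext_word i)) (wpar w).
  apply: parityM (parity_ext_coord _ _) (tensor_coef_homog w (ext_word j) hM) _.
  by rewrite /ext_par h.
by rewrite ext_coord_wpar // mul0r; apply: parity0.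
Qed.

Lemma coords_word_tensor k (j : 'I_(size (ext_words p q k))) :
  coords k (wtensor (ext_word j)) = delta_mx j 0.
Proof.
apply/matrixP => i o; rewrite !mxE ord1 andbT pairing_word_tensor ?size_ext_word //.
exact: ext_coordE.
Qed.

Lemma tdegree_tcomb k m (b : 'I_m -> tensor) (x : 'I_m -> A) :
  (forall i, tdegree k (b i)) -> tdegree k (tcomb b x).
Proof. by move=> bk w wk; apply: big1 => i _; rewrite bk ?mul0r. Qed.

Lemma is_ext_traceP k M : even_mx gr M ->
  is_ext_trace gr k M (supertrace (@ext_par k) (ext_mx k M)).
Proof.
move=> hM; pose b (i : 'I_(size (ext_words p q k))) := wtensor (ext_word i).
have bk i : tdegree k (b i) by apply/tdegree_word_tensor/size_ext_word.
have bcol : \matrix_(i, j) (coords k (b j)) i 0 = 1%:M.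
  by apply/matrixP => i j; rewrite mxE coords_word_tensor !mxE eqxx andbT.
exists (size (ext_words p q k)), (@ext_par k), b, (ext_mx k M); split=> //.
- split=> //.
  + move=> i w; rewrite /b /word_tensor; case: eqP => [->|_]; last exact: parity0.
    by rewrite addbb; apply: parity1.
  + move=> t tk; exists (fun i => coords k t i 0).
    apply: (@eq_coords_ideal k) => //; first exact: tdegree_tcomb.
    by rewrite coords_tcomb bcol mul1mx; apply/matrixP => i j; rewrite mxE ord1.
  + move=> x /(coords_ideal k); rewrite coords_tcomb bcol mul1mx => /matrixP h i.
    by have := h i 0; rewrite !mxE.
- move=> j; apply: (@eq_coords_ideal k); [exact: tdegree_tensor_map|exact: tdegree_tcomb|].
  rewrite coords_tensor_map // coords_word_tensor coords_tcomb bcol mul1mx.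
  by apply/matrixP => i o; rewrite -colE !mxE.
Qed.

End ExteriorTrace.

(** * Independence of the basis and invariance under conjugation *)

Section TraceInvariance.
Variables (K : fieldType) (A : algType K) (gr : supercomm_grading A) (p q : nat).
Hypothesis two_neq0 : 2%:R != 0 :> K.
Notation I := 'I_(p + q).
Notation tensor := (seq I -> A).
Notation par := (has_parity gr).
Notation tw := (twist gr).
Implicit Types (x y z : I) (u v w : seq I) (t s : tensor) (G : tensor) (k : nat).
Implicit Types (M N C : 'M[A]_(p + q)).
Notation wtensor := (@word_tensor K A p q).
Notation epar := (@ext_par p q _).

(** X is the change of basis from b to the sorted words. It is homogeneous and invertible and
    intertwines N with [ext_mx], so [supertrace_mulC] applies. *)
Lemma is_ext_trace_unique k M c : even_mx gr M -> is_ext_trace gr k M c ->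
  c = supertrace epar (ext_mx gr k M).
Proof.
move=> hM [m [s [b [N [[bk bs span indep] MN ->]]]]].
pose X := \matrix_(i, j) (coords k (b j)) i 0.
have hX : homog_mx gr epar s X.
  by move=> i j; rewrite !mxE; apply: parity_pairing (bs j).
have [Y0 hY0] : exists Y : 'I_(size (ext_words p q k)) -> 'I_m -> A,
    forall j, ext_ideal gr (fun w => wtensor (ext_word j) w - tcomb b (Y j) w).
  pose P j Yj := ext_ideal gr (fun w => wtensor (@ext_word p q k j) w - tcomb b Yj w).
  have hP j : exists Yj, P j Yj by apply/span/tdegree_word_tensor/size_ext_word.
  by have [Y hY] := boolp.choice hP; exists Y.
have XY0 : X *m (\matrix_(i, j) Y0 j i) = 1%:M.
  apply/matrixP => i j; have := coords_ideal two_neq0 k (hY0 j).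
  rewrite coordsB coords_tcomb coords_word_tensor => /eqP; rewrite subr_eq0 => /eqP/matrixP/(_ i 0).
  rewrite !mxE eqxx andbT => ->; apply: eq_bigr => l _; by rewrite !mxE.
(* The expansions of the sorted words in b were chosen arbitrarily; the component makes the right
   inverse homogeneous. *)
pose Y := mx_component gr s epar (\matrix_(i, j) Y0 j i).
have hY : homog_mx gr s epar Y by apply: mx_componentP.
have XY : X *m Y = 1%:M by apply: homog_right_inverse hX XY0.
have X_inj n (Z : 'M_(m, n)) : X *m Z = 0 -> Z = 0.
  move=> XZ; apply/matrixP => i j; rewrite mxE.
  have : ext_ideal gr (tcomb b (Z^~ j)).
    apply: (@coords_eq0_ideal K A gr p q two_neq0 k); first exact: tdegree_tcomb.
    rewrite coords_tcomb; apply/matrixP => l o.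
    transitivity ((X *m Z) l j); last by rewrite XZ !mxE.
    by rewrite [LHS]mxE [RHS]mxE; apply: eq_bigr => r _; rewrite [in LHS]mxE [X in _ * X]mxE !mxE.
  by move/indep => ->.
(* The independence of b makes X injective, which turns the right inverse into a two-sided one
   without a comparison of ranks. *)
have YX : Y *m X = 1%:M.
  by apply/eqP; rewrite -subr_eq0; apply/eqP/X_inj; rewrite mulmxBr mulmxA XY mul1mx mulmx1 subrr.
have XN : X *m N = ext_mx gr k M *m X.
  apply/matrixP => i j; have := coords_ideal two_neq0 k (MN j).
  rewrite coordsB (coords_tensor_map two_neq0 hM (bk j)) coords_tcomb => /eqP.
  rewrite subr_eq0 => /eqP/matrixP/(_ i 0); rewrite !mxE => h.
  transitivity (\sum_j0 (\matrix_(i1, j1) coords k (b j1) i1 0) i j0 * (\col_j1 N j1 j) j0 0).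
    by apply: eq_bigr => l _; rewrite !mxE.
  by rewrite -h; apply: eq_bigr => l _; rewrite !mxE.
have -> : N = Y *m (ext_mx gr k M *m X) by rewrite -XN mulmxA YX mul1mx.
rewrite (supertrace_mulC hY (homog_mxM (ext_mx_homog hM) hX)).
by rewrite -mulmxA XY mulmx1.
Qed.

Lemma ext_traceE k M : even_mx gr M ->
  ext_trace gr k%:Z M = supertrace epar (ext_mx gr k M).
Proof.
move=> hM; apply: is_ext_trace_unique => //.
exact: (xgetPex 0 (ex_intro _ _ (is_ext_traceP two_neq0 k hM))).
Qed.

Lemma tensor_coefM M N w v : even_mx gr M -> size w = size v ->
  tensor_coef gr (M *m N) w v = \sum_(u : (size v).-tuple I) tensor_coef gr M w u * tensor_coef gr N u v.
Proof.
move=> hM; elim: w v => [|a w IHw] [|c v] //=.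
  by move=> _; rewrite (sum_tuple0 (fun u => tensor_coef gr M [::] u * tensor_coef gr N u [::])) mulr1.
case=> wv; rewrite (sum_tupleS _ (fun u => tensor_coef gr M (a :: w) u * tensor_coef gr N u (c :: v))).
rewrite IHw // mxE twist_sum mulr_suml; apply: eq_bigr => b _; rewrite mulr_sumr.
apply: eq_bigr => u _ /=; rewrite twistM -!mulrA; congr (_ * _); rewrite !mulrA; congr (_ * _).
by rewrite (supercomm _ (tensor_coef_homog w u hM)) twistK -addbA addbb addbF.
Qed.

Lemma tensor_mapM M N t : even_mx gr M ->
  tensor_map gr (M *m N) t = tensor_map gr M (tensor_map gr N t).
Proof.
move=> hM; apply/funext => w; rewrite !tensor_mapE.
under eq_bigr => v _ do rewrite (tensor_coefM _ hM) ?size_tuple // mulr_suml.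
under [RHS]eq_bigr => v _ do rewrite tensor_mapE size_tuple mulr_sumr.
rewrite exchange_big; apply: eq_bigr => u _; apply: eq_bigr => v _ /=.
by rewrite mulrA.
Qed.

Lemma even_mxM M N : even_mx gr M -> even_mx gr N -> even_mx gr (M *m N).
Proof. exact: homog_mxM. Qed.

Lemma ext_mxM k M N : even_mx gr M -> even_mx gr N ->
  ext_mx gr k (M *m N) = ext_mx gr k M *m ext_mx gr k N.
Proof.
move=> hM hN; apply/matrixP => i j.
have wk := @tdegree_word_tensor K A p q k _ (size_ext_word j).
have /matrixP/(_ i 0) := coords_tensor_map two_neq0 (even_mxM hM hN) wk.
rewrite tensor_mapM // (coords_tensor_map two_neq0 hM (tdegree_tensor_map gr N wk)).
rewrite (coords_tensor_map two_neq0 hN wk) mulmxA coords_word_tensor -!colE.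
by rewrite !mxE => <-.
Qed.

Lemma tensor_coef_diag (d : 'rV[A]_(p + q)) w u : (forall x, par false (d 0 x)) ->
  tensor_coef gr (diag_mx d) w u = wtensor w u * \prod_(y <- w) d 0 y.
Proof.
move=> hd; rewrite /word_tensor.
elim: w u => [|y w IHw] [|x u] /=; rewrite ?big_nil ?mulr1 ?mul0r //.
rewrite IHw mxE big_cons eqseq_cons [x == y]eq_sym.
case: eqP => [->|_] /=; last by rewrite mulr0n twist0 !mul0r.
rewrite mulr1n (twist_even _ (hd x)); case: eqP => _; rewrite ?mul1r ?mul0r ?mulr0 //.
Qed.

Lemma dual_map_diag (d : 'rV[A]_(p + q)) G u : (forall x, par false (d 0 x)) ->
  dual_map gr (diag_mx d) G u = G u * \prod_(y <- u) d 0 y.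
Proof.
move=> hd; rewrite /dual_map.
rewrite -(sum_word_tensor (fun w => G w * \prod_(y <- w) d 0 y) (erefl (size u))).
apply: eq_bigr => w _; rewrite tensor_coef_diag // /word_tensor.
by case: eqP; rewrite ?mul1r ?mul0r ?mulr0.
Qed.

Lemma ext_trace_diag k (d : 'rV[A]_(p + q)) : (forall x, par false (d 0 x)) ->
  ext_trace gr k%:Z (diag_mx d) =
  \sum_(w <- ext_words p q k) (-1) ^+ wpar w * \prod_(y <- w) d 0 y.
Proof.
move=> hd; rewrite ext_traceE; last first.
  move=> i j; rewrite mxE; case: eqP => [->|_]; last exact: parity0.
  by rewrite addbb; apply: hd.
rewrite big_ext_words; apply: eq_bigr => i _; rewrite mxE dual_map_diag //.
by rewrite ext_coordE eqxx mul1r.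
Qed.

Lemma ext_mx1 k : ext_mx gr k (1%:M : 'M[A]_(p + q)) = 1%:M.
Proof.
rewrite -diag_const_mx; apply/matrixP => i j; rewrite [LHS]mxE dual_map_diag => [|x].
  rewrite big1 => [|y _]; last by rewrite mxE.
  by rewrite mulr1 ext_coordE !mxE.
by rewrite mxE; apply: parity1.
Qed.

Lemma even_inverse C Ci : even_invertible_mx gr C Ci -> even_mx gr Ci.
Proof. by case=> hC CCi CiC; apply: homog_invmx hC CCi CiC. Qed.

Lemma ext_trace_conj (k : int) M C Ci : even_mx gr M -> even_invertible_mx gr C Ci ->
  ext_trace gr k (Ci *m M *m C) = ext_trace gr k M.
Proof.
move=> hM hC; have hCi := even_inverse hC; have [eC CCi CiC] := hC.
case: k => [k|//]; rewrite !ext_traceE //; last by do !apply: even_mxM.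
rewrite !ext_mxM //; last exact: even_mxM.
rewrite -mulmxA (supertrace_mulC (ext_mx_homog hCi) (homog_mxM (ext_mx_homog hM) (ext_mx_homog eC))).
by rewrite -mulmxA -ext_mxM // CCi ext_mx1 mulmx1.
Qed.

Lemma ext_trace_even (k : int) M : even_mx gr M -> par false (ext_trace gr k M).
Proof.
move=> hM; case: k => [k|k]; last exact: parity0.
rewrite ext_traceE //; apply: parity_sum => i _; apply: parity_signM.
by have := ext_mx_homog (k := k) hM i i; rewrite addbb.
Qed.

End TraceInvariance.

Lemma enum_ordD m n : enum 'I_(m + n) = map (lshift n) (enum 'I_m) ++ map (@rshift m n) (enum 'I_n).
Proof.
apply: (inj_map val_inj); rewrite map_cat val_enum_ord iotaD; congr (_ ++ _).
  by rewrite -val_enum_ord -[RHS]map_comp.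
rewrite add0n -[m in LHS]addn0 iotaDl -val_enum_ord -[RHS]map_comp -[LHS]map_comp.
exact: eq_map.
Qed.

(** * Traces of diagonal operators *)

Section WordSums.
Variables (S : comNzRingType) (p q : nat) (d : 'I_(p + q) -> S).

(** As a series in t with coefficients indexed by k, an even letter contributes a factor 1 + d t.
    For an odd letter the words beginning with it give back the same series, which amounts to a
    division by 1 + d t. *)
Lemma sum_basis_words (L : seq 'I_(p + q)) (k : nat) :
  \sum_(w <- basis_words L k) (-1) ^+ wpar w * \prod_(y <- w) d y =
  supercoef [seq d x | x <- L & ~~ ipar x] [seq d x | x <- L & ipar x] k.
Proof.
elim: L k => [|x L IHL] k.
  case: k => [|k]; last by rewrite big_nil.
  by rewrite big_seq1 big_nil mulr1 expr0.
elim: k => [|k IHk].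
  by rewrite supercoef0 basis_words0 big_seq1 big_nil mulr1 expr0.
rewrite basis_wordsS big_cat IHL big_map /=.
under [X in _ + X]eq_bigr => w _ do rewrite wpar_cons big_cons signr_addb mulrACA.
rewrite -mulr_sumr; move: IHk; have k1 : k.+1%:Z - 1 = k by lia.
have [hx|hx] := boolP (ipar x); rewrite /= ?hx ?(negPf hx) /= => IHk.
  rewrite IHk expr1 mulN1r -(supercoef_consr (d x) _ _ k.+1) k1.
  by rewrite mulNr addrK.
by rewrite expr0 mul1r IHL supercoef_consl /mulseq k1.
Qed.

Lemma sum_ext_words k : \sum_(w <- ext_words p q k) (-1) ^+ wpar w * \prod_(y <- w) d y =
  supercoef [seq d (lshift q i) | i <- enum 'I_p] [seq d (rshift p a) | a <- enum 'I_q] k.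
Proof.
rewrite sum_basis_words enum_ordD !filter_cat.
have hl : [seq x <- map (lshift q) (enum 'I_p) | ~~ ipar x] = map (lshift q) (enum 'I_p).
  by apply/all_filterP/allP => _ /mapP[i _ ->]; rewrite /ipar /= -ltnNge.
have hl' : [seq x <- map (lshift q) (enum 'I_p) | ipar x] = [::].
  by rewrite -[RHS](filter_pred0 (map (lshift q) (enum 'I_p))); apply: eq_in_filter => _ /mapP[i _ ->];
    rewrite /ipar /= leqNgt ltn_ord.
have hr : [seq x <- map (@rshift p q) (enum 'I_q) | ipar x] = map (@rshift p q) (enum 'I_q).
  by apply/all_filterP/allP => _ /mapP[i _ ->]; rewrite /ipar /= leq_addr.
have hr' : [seq x <- map (@rshift p q) (enum 'I_q) | ~~ ipar x] = [::].
  by rewrite -[RHS](filter_pred0 (map (@rshift p q) (enum 'I_q))); apply: eq_in_filter => _ /mapP[i _ ->];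
    rewrite /ipar /= leq_addr.
by rewrite hl hl' hr hr' cats0 -!map_comp.
Qed.

End WordSums.

(** * The commutative ring of even scalars *)

Section EvenPart.
Variables (K : fieldType) (A : algType K) (gr : supercomm_grading A).

Definition even_elem : {pred A} := fun x => gproj gr false x == x.

(** The coefficient identities hold over commutative rings; this central subring is where they apply
    to [A]. *)
Record even_part := EvenPart {even_val : A; _ : even_val \in even_elem}.
HB.instance Definition _ := [isSub for even_val].
HB.instance Definition _ := [Choice of even_part by <:].

Lemma even_elemP x : reflect (has_parity gr false x) (x \in even_elem).
Proof. exact: eqP. Qed.

Lemma even_elem_subring : subring_closed even_elem.
Proof.
split=> [|x y|x y]; first exact/even_elemP/parity1.
- by move=> /even_elemP hx /even_elemP hy; apply/even_elemP/parityB.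
- by move=> /even_elemP hx /even_elemP hy; apply/even_elemP/(parityM hx hy).
Qed.

HB.instance Definition _ := GRing.SubChoice_isSubNzRing.Build A even_elem even_part even_elem_subring.

Lemma even_part_mulC : @commutative even_part even_part *%R.
Proof.
move=> [x hx] [y hy]; apply: val_inj; rewrite !rmorphM /=.
exact/even_central/even_elemP.
Qed.
HB.instance Definition _ := GRing.PzRing_hasCommutativeMul.Build even_part even_part_mulC.

Definition even_incl (x : even_part) : A := val x.

Lemma even_incl_is_additive : additive even_incl. Proof. exact: raddfB. Qed.
Lemma even_incl_is_multiplicative : multiplicative even_incl.
Proof. by split=> [x y|]; [apply: rmorphM | apply: rmorph1]. Qed.
HB.instance Definition _ := GRing.isZmodMorphism.Build even_part A even_incl even_incl_is_additive.
HB.instance Definition _ := GRing.isMultiplicative.Build even_part A even_incl even_incl_is_multiplicative.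

Lemma even_incl_parity (x : even_part) : has_parity gr false (even_incl x).
Proof. exact/even_elemP/(valP x). Qed.

Lemma even_part_lift x : has_parity gr false x -> exists x0 : even_part, even_incl x0 = x.
Proof. by move/even_elemP => hx; exists (EvenPart hx). Qed.

Lemma even_scalar_subproof (k : K) : k%:A \in even_elem.
Proof. exact/even_elemP/parityZ/parity1. Qed.

Definition even_scalar (k : K) : even_part := EvenPart (even_scalar_subproof k).

Lemma even_scalar_is_additive : additive even_scalar.
Proof. by move=> x y; apply: val_inj; rewrite raddfB /= scalerBl. Qed.

Lemma even_scalar_is_multiplicative : multiplicative even_scalar.
Proof.
split=> [x y|]; apply: val_inj; rewrite ?rmorphM ?rmorph1 /= ?scale1r //.
by rewrite -scalerAl mul1r scalerA.
Qed.

HB.instance Definition _ := GRing.isZmodMorphism.Build K even_part even_scalar even_scalar_is_additive.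
HB.instance Definition _ := GRing.isMultiplicative.Build K even_part even_scalar even_scalar_is_multiplicative.

(** As [A] is not commutative, substitution into [A] is not a ring morphism; at even values it
    factors through one. *)
Lemma mmap_even n (h : 'I_n -> even_part) (P : {mpoly K[n]}) :
  mmap (fun c : K => c%:A : A) (fun j => even_incl (h j)) P = even_incl (mmap even_scalar h P).
Proof.
rewrite /mmap rmorph_sum; apply: eq_bigr => m _; rewrite rmorphM; congr (_ * _).
by rewrite /mmap1 rmorph_prod; apply: eq_bigr => j _; rewrite rmorphXn.
Qed.

End EvenPart.

(** * Traces and eigenvalues *)

Section Eigenvalues.
Variables (K : fieldType) (A : algType K) (gr : supercomm_grading A) (p q : nat).
Hypothesis two_neq0 : 2%:R != 0 :> K.
Implicit Types (M C : 'M[A]_(p + q)) (f g : {poly A}).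
Notation S := (even_part gr).
Notation ev := (@even_incl K A gr).
Notation vp := (map_poly ev).

Lemma Ptilde_at_even M (c : int -> S) : (forall k, ev (c k) = ext_trace gr k M) ->
  Ptilde_at gr M = vp (map_poly (mmap (even_scalar gr) (fun j => c (j%:Z - q%:Z))) (Ptilde K p q)).
Proof.
move=> cE; rewrite /Ptilde_at.
have -> : (fun j : 'I_(nvars p q) => ext_trace gr (j%:Z - q%:Z) M) = (fun j => ev (c (j%:Z - q%:Z))).
  by apply/funext => j; rewrite cE.
apply/polyP => i; rewrite coef_map /=.
have m0 : mmap (fun c : K => c%:A : A) (fun j : 'I_(nvars p q) => ev (c (j%:Z - q%:Z))) 0 = 0.
  by rewrite mmap_even mmap0 rmorph0.
rewrite coef_map_id0 // coef_map_id0 ?mmap0 //.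
exact: mmap_even.
Qed.

Definition spectrum n (x : 'rV[S]_n) : seq S := [seq x 0 i | i <- enum 'I_n].

Lemma size_spectrum n (x : 'rV[S]_n) : size (spectrum x) = n.
Proof. by rewrite size_map size_enum_ord. Qed.

Lemma big_spectrum (R : Type) (idx : R) (op : Monoid.com_law idx) n (x : 'rV[S]_n) (F : S -> R) :
  \big[op/idx]_(l <- spectrum x) F l = \big[op/idx]_(i < n) F (x 0 i).
Proof. by rewrite big_map big_enum. Qed.

Lemma lift_row n (x : 'rV[A]_n) : (forall i, has_parity gr false (x 0 i)) ->
  exists x0 : 'rV[S]_n, x = map_mx ev x0.
Proof.
move=> hx; have h i := even_part_lift (hx i); have [f hf] := boolp.choice h.
by exists (\row_i f i); apply/matrixP => i j; rewrite ord1 !mxE hf.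
Qed.

Lemma ext_trace_eigen M (lam : 'rV[S]_p) (mu : 'rV[S]_q) (k : int) : even_mx gr M ->
  eigenvalues gr M (map_mx ev lam) (map_mx ev mu) ->
  ext_trace gr k M = ev (supercoef (spectrum lam) (spectrum mu) k).
Proof.
move=> hM [_ _ [C [Ci [hC MC]]]]; have [eC CCi CiC] := hC.
have eCi := even_inverse hC.
rewrite -(ext_trace_conj two_neq0 k hM hC) -mulmxA MC mulmxA CiC mul1mx.
case: k => [k|k]; last by rewrite (supercoef_neg _ _ k) rmorph0.
rewrite -map_row_mx ext_trace_diag //; last by move=> x; rewrite mxE; apply: even_incl_parity.
have -> : supercoef (spectrum lam) (spectrum mu) k =
    \sum_(w <- ext_words p q k) (-1) ^+ wpar w * \prod_(y <- w) row_mx lam mu 0 y.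
  rewrite sum_ext_words; congr (supercoef _ _ _); apply: eq_map => i.
    by rewrite row_mxEl.
  by rewrite row_mxEr.
rewrite rmorph_sum; apply: eq_bigr => w _; rewrite rmorphM rmorph_sign rmorph_prod.
by congr (_ * _); apply: eq_bigr => y _; rewrite mxE.
Qed.

End Eigenvalues.

(** * Annihilating polynomials of diagonalizable operators *)

Lemma mxeval_widen (A : nzRingType) n (M : 'M[A]_n) (f : {poly A}) N : (size f <= N)%N ->
  mxeval M f = \sum_(k < N) f`_k *: M ^+ k.
Proof.
move=> fN; rewrite /mxeval (big_ord_widen _ (fun k => f`_k *: M ^+ k) fN) big_mkcond.
by apply: eq_bigr => k _; case: ltnP => // h; rewrite nth_default // scale0r.
Qed.

Section Invertible.
Variable A : nzRingType.
Lemma invertible1 : invertible (1 : A). Proof. by exists 1; rewrite mul1r. Qed.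

Lemma invertibleM (x y : A) : invertible x -> invertible y -> invertible (x * y).
Proof.
move=> [x' [xx' x'x]] [y' [yy' y'y]]; exists (y' * x').
by split; rewrite -mulrA ?(mulrA y) ?(mulrA x') ?yy' ?x'x mul1r.
Qed.

Lemma invertible_prod (I : Type) (r : seq I) (F : I -> A) :
  (forall i, invertible (F i)) -> invertible (\prod_(i <- r) F i).
Proof. by move=> h; elim/big_ind: _ => //; [apply: invertible1 | apply: invertibleM]. Qed.

Lemma invertible_sign (x : A) n : invertible x -> invertible ((-1) ^+ n * x).
Proof.
apply: invertibleM; exists ((-1) ^+ n); split; by rewrite -exprD addnn -signr_odd odd_double.
Qed.

(** Since the d i are central, evaluation at them is multiplicative; since their differences are
    invertible, the other roots pass to the quotient. Factors are split off on the right, whence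
    [rev]. *)
Lemma factor_central_roots (I : eqType) (d : I -> A) (s : seq I) (f : {poly A}) :
  (forall i x, d i * x = x * d i) ->
  (forall i j, i != j -> invertible (d i - d j)) ->
  uniq s -> (forall i, i \in s -> f.[d i] = 0) ->
  exists g, f = g * \prod_(i <- rev s) ('X - (d i)%:P).
Proof.
move=> d_central d_inv; elim: s f => [|i s IHs] f; first by exists f; rewrite big_nil mulr1.
move=> /andP[is_ us] f0; have /factor_theorem[g gE] : root f (d i).
  by apply/rootP/f0; rewrite mem_head.
have [h hE] : exists h, g = h * \prod_(j <- rev s) ('X - (d j)%:P).
  apply: IHs => // j js; have := f0 j; rewrite inE js orbT gE => /(_ isT).
  rewrite hornerM_comm; last by rewrite /comm_poly -d_central.
  rewrite hornerXsubC; have [|y [yE _]] := d_inv j i.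
    by apply: contraNneq is_ => <-.
  by move=> /(congr1 (fun x => x * y)); rewrite -mulrA yE mulr1 mul0r.
by exists h; rewrite rev_cons big_rcons /= mulrA -hE.
Qed.

End Invertible.

Section Diagonalizable.
Variables (K : fieldType) (A : algType K) (gr : supercomm_grading A) (p q : nat).
Hypothesis two_neq0 : 2%:R != 0 :> K.
Implicit Types (M C : 'M[A]_(p + q)) (f g : {poly A}).
Notation S := (even_part gr).
Notation ev := (@even_incl K A gr).
Notation vp := (map_poly ev).

Lemma mxeval_eigen M C (d : 'rV[A]_(p + q)) f : (forall j, has_parity gr false (d 0 j)) ->
  M *m C = C *m diag_mx d -> mxeval M f *m C = \matrix_(i, j) (f.[d 0 j] * C i j).
Proof.
move=> hd MC; have MkC k : M ^+ k *m C = C *m diag_mx (\row_j d 0 j ^+ k).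
  elim: k => [|k IHk].
    rewrite expr0 mul1mx (_ : diag_mx _ = 1%:M) ?mulmx1 //.
    by rewrite -diag_const_mx; congr diag_mx; apply/rowP => j; rewrite !mxE.
  rewrite exprSr -mulmxA MC mulmxA IHk -mulmxA; congr (_ *m _).
  by rewrite mulmx_diag; congr diag_mx; apply/rowP => j; rewrite !mxE exprSr.
rewrite /mxeval mulmx_suml; apply/matrixP => i j; rewrite summxE !mxE horner_coef mulr_suml.
apply: eq_bigr => k _; rewrite -scalemxAl MkC mul_mx_diag !mxE -mulrA; congr (_ * _).
by rewrite (even_central _ (parityX _ (hd j))).
Qed.

Lemma annihilates_eigen M C Ci (d : 'rV[A]_(p + q)) f :
  (forall j, has_parity gr false (d 0 j)) -> even_invertible_mx gr C Ci ->
  M *m C = C *m diag_mx d -> annihilates f M <-> forall j, f.[d 0 j] = 0.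
Proof.
move=> hd [eC CCi CiC] MC; have MfC := mxeval_eigen f hd MC; split=> [Mf0 j|f0].
  have fC i : f.[d 0 j] * C i j = 0.
    by have /matrixP/(_ i j) := MfC; rewrite Mf0 mul0mx !mxE.
  have C1 : \sum_i Ci j i * C i j = 1 by have /matrixP/(_ j j) := CiC; rewrite !mxE eqxx.
  rewrite -[LHS]mulr1 -C1 mulr_sumr big1 // => i _.
  (* The value of f is known to kill C i j only from the left, so y is moved to the right of C i j
     at the cost of a twist. *)
  set y := Ci j i; rewrite (_ : y * C i j = C i j * twist gr (ipar i (+) ipar j) y).
    by rewrite mulrA fC mul0r.
  by rewrite (supercomm _ (eC i j)) twistK addbb twist_false.
rewrite /annihilates -[LHS]mulmx1 -CCi mulmxA MfC.
by apply/matrixP => i j; rewrite !mxE big1 // => k _; rewrite !mxE f0 !mul0r.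
Qed.

Lemma map_even_CsubX (l : S) : vp (l%:P - 'X) = (ev l)%:P - 'X.
Proof. by rewrite rmorphB /= map_polyC map_polyX. Qed.

Lemma map_even_XsubC (l : S) : vp ('X - l%:P) = 'X - (ev l)%:P.
Proof. by rewrite rmorphB /= map_polyC map_polyX. Qed.

Lemma map_even_1addX (l : S) : vp (1 + l *: 'X) = 1 + ev l *: 'X.
Proof. by rewrite rmorphD rmorph1 /= map_polyZ map_polyX. Qed.

Section Spectrum.
Variables (M : 'M[A]_(p + q)) (lam : 'rV[S]_p) (mu : 'rV[S]_q).
Hypothesis hM : even_mx gr M.
Hypothesis Meig : eigenvalues gr M (map_mx ev lam) (map_mx ev mu).

Let Res : S := \prod_(m <- spectrum mu) \prod_(l <- spectrum lam) (l - m).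

Lemma eigen_resultantE : eigen_resultant (map_mx ev lam) (map_mx ev mu) = ev Res.
Proof.
rewrite /Res exchange_big big_spectrum rmorph_prod; apply: eq_bigr => i _.
rewrite big_spectrum rmorph_prod; apply: eq_bigr => a _.
by rewrite rmorphB !mxE.
Qed.

Lemma naive_charpolyE : naive_charpoly (map_mx ev lam) (map_mx ev mu) =
  vp (\prod_(l <- spectrum lam) (l%:P - 'X) * \prod_(m <- spectrum mu) (m%:P - 'X)).
Proof.
rewrite rmorphM !big_spectrum !rmorph_prod /naive_charpoly.
by congr (_ * _); apply: eq_bigr => i _; rewrite /= map_even_CsubX mxE.
Qed.

Lemma charfactorE n (x : 'rV[S]_n) : charfactor (map_mx ev x) = vp (linfactors (spectrum x)).
Proof.
rewrite /linfactors big_spectrum rmorph_prod; apply: eq_bigr => i _.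
by rewrite /= map_even_1addX mxE.
Qed.

Lemma formal_resultantE :
  formal_resultant q p (charfactor (map_mx ev mu)) (charfactor (map_mx ev lam)) = ev Res.
Proof.
rewrite /Res -det_sylvester -det_map_mx /formal_resultant !charfactorE.
have h n m (n' m' : nat) : n = n' -> m = m' ->
  \det (col_mx (\matrix_(i < n, j < n + m) ('X^i * vp (linfactors (spectrum mu)))`_j)
               (\matrix_(i < m, j < n + m) ('X^i * vp (linfactors (spectrum lam)))`_j)) =
  \det (map_mx ev (col_mx (\matrix_(i < n', j < n' + m') ('X^i * linfactors (spectrum mu))`_j)
               (\matrix_(i < m', j < n' + m') ('X^i * linfactors (spectrum lam))`_j))).
  move=> -> ->; congr (\det _); rewrite map_col_mx.
  by congr col_mx; apply/matrixP => i j; rewrite !mxE -coef_map rmorphM /= map_polyXn.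
by rewrite (h _ _ _ _ (esym (size_spectrum lam)) (esym (size_spectrum mu))).
Qed.

Lemma Ptilde_at_eigen : Ptilde_at gr M =
  (-1) ^+ 'C(q, 2) *: (eigen_resultant (map_mx ev lam) (map_mx ev mu) *:
     naive_charpoly (map_mx ev lam) (map_mx ev mu)).
Proof.
rewrite (Ptilde_at_even (c := supercoef (spectrum lam) (spectrum mu))); last first.
  by move=> k; rewrite (ext_trace_eigen two_neq0 k hM Meig).
rewrite (map_Ptilde_size (even_scalar gr) (size_spectrum lam) (size_spectrum mu)) //.
by rewrite map_polyZ -naive_charpolyE rmorphM rmorph_sign scalerA eigen_resultantE.
Qed.

(** This expresses the resultant through traces alone, hence as a quantity that makes sense for
    every even operator. *)
Lemma det_toeplitz_trace :
  \det (\matrix_(i < q, j < q) ext_trace gr (p%:Z + j%:Z - i%:Z) M) =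
  eigen_resultant (map_mx ev lam) (map_mx ev mu).
Proof.
rewrite eigen_resultantE /Res -det_toeplitz !size_spectrum -det_map_mx; congr (\det _).
by apply/matrixP => i j; rewrite !mxE (ext_trace_eigen two_neq0 _ hM Meig).
Qed.

Let d := row_mx (map_mx ev lam) (map_mx ev mu) : 'rV[A]_(p + q).

(** The double reversal is the shape that [factor_central_roots] yields for the list
    [rev (enum _)]. *)
Lemma Ptilde_at_monic : Ptilde_at gr M =
  ((-1) ^+ ('C(q, 2) + (p + q)) * ev Res) *:
    \prod_(j <- rev (rev (enum 'I_(p + q)))) ('X - (d 0 j)%:P).
Proof.
rewrite Ptilde_at_eigen eigen_resultantE naive_charpolyE -big_cat prod_CsubX.
rewrite size_cat !size_spectrum map_polyZ !scalerA rmorph_sign (exprD _ 'C(q, 2)).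
rewrite -!mulrA commr_sign; congr (_ *: _).
rewrite revK rmorph_prod enum_ordD !big_cat /= !big_map.
by congr (_ * _); apply: eq_bigr => i _; rewrite /= map_even_XsubC /d ?row_mxEl ?row_mxEr mxE.
Qed.

Lemma Ptilde_at_annihilates : annihilates (Ptilde_at gr M) M.
Proof.
have [_ _ [C [Ci [hC MC]]]] := Meig.
have hd j : has_parity gr false (d 0 j).
  by rewrite /d -map_row_mx mxE; apply: even_incl_parity.
apply/(annihilates_eigen _ hd hC MC) => j.
rewrite Ptilde_at_monic hornerZ (_ : \prod_(_ <- _) _ =
  vp (\prod_(j <- rev (rev (enum 'I_(p + q)))) ('X - (row_mx lam mu 0 j)%:P))); last first.
  rewrite rmorph_prod; apply: eq_bigr => i _; rewrite /= map_even_XsubC /d.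
  by rewrite -map_row_mx mxE.
rewrite /d -map_row_mx mxE horner_map /= horner_prod revK (bigD1_seq j) ?mem_enum ?enum_uniq //=.
by rewrite hornerXsubC subrr mul0r rmorph0 mulr0.
Qed.

Lemma Ptilde_at_minimal : generic (map_mx ev lam) (map_mx ev mu) ->
  minimal_poly (Ptilde_at gr M) M /\
  (forall f, annihilates f M -> exists g, f = g * Ptilde_at gr M).
Proof.
case=> lam_inv lammu_inv mu_inv.
have [_ _ [C [Ci [hC MC]]]] := Meig.
have hd j : has_parity gr false (d 0 j).
  by rewrite /d -map_row_mx mxE; apply: even_incl_parity.
have d_inv i j : i != j -> invertible (d 0 i - d 0 j).
  rewrite /d; case: (split_ordP i) => i' ->; case: (split_ordP j) => j' -> ij.
  - by rewrite !row_mxEl; apply: lam_inv; apply: contraNneq ij => ->.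
  - by rewrite row_mxEl row_mxEr; apply: lammu_inv.
  - rewrite row_mxEl row_mxEr -opprB -mulN1r -[-1]expr1; exact/invertible_sign/lammu_inv.
  - by rewrite !row_mxEr; apply: mu_inv; apply: contraNneq ij => ->.
set P := \prod_(j <- rev (rev (enum 'I_(p + q)))) ('X - (d 0 j)%:P).
have [u [v [PE vu]]] : exists u v, Ptilde_at gr M = u *: P /\ v * u = 1.
  exists ((-1) ^+ ('C(q, 2) + (p + q)) * ev Res).
  have [|v [_ vu]] := @invertible_sign _ (ev Res) ('C(q, 2) + (p + q)).
    rewrite -eigen_resultantE; do 2![apply: invertible_prod => ?]; exact: lammu_inv.
  by exists v; rewrite Ptilde_at_monic.
have u_neq0 : u != 0 by apply: contraTneq isT => u0; have := oner_neq0 A; rewrite -vu u0 mulr0 eqxx.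
have P_monic : P \is monic by apply: monic_prod_XsubC.
have fP f : annihilates f M -> exists g, f = g * P.
  move/(annihilates_eigen _ hd hC MC) => f0.
  apply: factor_central_roots => //; first by move=> i x; rewrite (even_central _ (hd i)).
  by rewrite rev_uniq enum_uniq.
split; first split.
- apply/eqP => /(congr1 (fun f : {poly A} => f`_(size P).-1)); rewrite PE coefZ coef0.
  by rewrite -/(lead_coef P) (monicP P_monic) mulr1 => u0; rewrite u0 eqxx in u_neq0.
- exact: Ptilde_at_annihilates.
- move=> f f_neq0 /fP[g fE]; rewrite PE; apply: leq_trans (size_scale_leq _ _) _.
  have g_neq0 : g != 0 by apply: contraNneq f_neq0 => g0; rewrite fE g0 mul0r.
  (* [A] may have zero divisors, but degrees still add when one factor is monic. *)
  rewrite fE size_Mmonic //; have := g_neq0; rewrite -size_poly_eq0.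
  by case: (size g) => // n _; rewrite addSn /= leq_addl.
- move=> f /fP[g ->]; exists (g * v%:P).
  by rewrite PE -mul_polyC -mulrA [v%:P * _]mulrA -polyCM vu mul1r.
Qed.

End Spectrum.
End Diagonalizable.

(** * Formal power series over a supercommutative algebra *)

(** A named copy of [nat -> A] to carry the convolution product. The variable s commutes with
    [A]. *)
Definition pseries (A : Type) : Type := nat -> A.

Section PowerSeries.
Variables (K : fieldType) (A : algType K).
Notation B := (pseries A).
Implicit Types (f g h : B).

HB.instance Definition _ := gen_eqMixin B.
HB.instance Definition _ := gen_choiceMixin B.

Definition ps_zero : B := fun=> 0.
Definition ps_opp f : B := fun n => - f n.
Definition ps_add f g : B := fun n => f n + g n.
Definition ps_one : B := fun n => (n == 0%N)%:R.
Definition ps_mul f g : B := fun n => \sum_(i < n.+1) f i * g (n - i)%N.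
Definition ps_scale (k : K) f : B := fun n => k *: f n.

Lemma ps_addA : associative ps_add. Proof. by move=> f g h; apply/funext => n; apply: addrA. Qed.
Lemma ps_addC : commutative ps_add. Proof. by move=> f g; apply/funext => n; apply: addrC. Qed.
Lemma ps_add0 : left_id ps_zero ps_add. Proof. by move=> f; apply/funext => n; apply: add0r. Qed.
Lemma ps_addN : left_inverse ps_zero ps_opp ps_add.
Proof. by move=> f; apply/funext => n; apply: addNr. Qed.

HB.instance Definition _ := GRing.isZmodule.Build B ps_addA ps_addC ps_add0 ps_addN.

Definition ps_trunc N f : {poly A} := \poly_(i < N) f i.

Lemma ps_mul_trunc N f g n : (n < N)%N -> ps_mul f g n = (ps_trunc N f * ps_trunc N g)`_n.
Proof.
move=> nN; rewrite coefM; apply: eq_bigr => i _; rewrite !coef_poly.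
by have := ltn_ord i => hi; rewrite !(leq_ltn_trans _ nN) ?leq_subr.
Qed.

(** A coefficient of a product depends only on truncations, so associativity comes from
    polynomials. *)
Lemma ps_mulA : associative ps_mul.
Proof.
move=> f g h; apply/funext => n.
have trunc_mul f1 f2 i : (i < n.+1)%N ->
    (ps_trunc n.+1 (ps_mul f1 f2))`_i = (ps_trunc n.+1 f1 * ps_trunc n.+1 f2)`_i.
  by move=> hi; rewrite coef_poly hi (ps_mul_trunc _ _ hi).
rewrite !(@ps_mul_trunc n.+1) // [LHS]coefM.
transitivity ((ps_trunc n.+1 f * (ps_trunc n.+1 g * ps_trunc n.+1 h))`_n).
  by rewrite coefM; apply: eq_bigr => i _; rewrite trunc_mul // ltnS leq_subr.
rewrite mulrA !coefM; apply: eq_bigr => i _; rewrite trunc_mul //.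
Qed.

Lemma ps_mul1 : left_id ps_one ps_mul.
Proof.
move=> f; apply/funext => n; rewrite /ps_mul big_ord_recl /= mul1r subn0 big1 ?addr0 // => i _.
by rewrite mul0r.
Qed.

Lemma ps_mulr1 : right_id ps_one ps_mul.
Proof.
move=> f; apply/funext => n; rewrite /ps_mul big_ord_recr /= subnn mulr1 big1 ?add0r // => i _.
by rewrite /ps_one subn_eq0 leqNgt ltn_ord mulr0.
Qed.

Lemma ps_mulDl : left_distributive ps_mul ps_add.
Proof.
move=> f g h; apply/funext => n; rewrite /ps_mul /ps_add -big_split; apply: eq_bigr => i _.
exact: mulrDl.
Qed.

Lemma ps_mulDr : right_distributive ps_mul ps_add.
Proof.
move=> f g h; apply/funext => n; rewrite /ps_mul /ps_add -big_split; apply: eq_bigr => i _.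
exact: mulrDr.
Qed.

Lemma ps_oner_neq0 : ps_one != 0.
Proof. by apply/eqP => /(congr1 (fun f : B => f 0%N)) /eqP; rewrite /ps_one oner_eq0. Qed.

HB.instance Definition _ := GRing.Zmodule_isNzRing.Build B
  ps_mulA ps_mul1 ps_mulr1 ps_mulDl ps_mulDr ps_oner_neq0.

Lemma ps_scaleA (a b : K) f : ps_scale a (ps_scale b f) = ps_scale (a * b) f.
Proof. by apply/funext => n; apply: scalerA. Qed.
Lemma ps_scale1 : left_id 1 ps_scale. Proof. by move=> f; apply/funext => n; apply: scale1r. Qed.
Lemma ps_scaleDr : right_distributive ps_scale +%R.
Proof. by move=> a f g; apply/funext => n; apply: scalerDr. Qed.
Lemma ps_scaleDl f : {morph ps_scale^~ f : a b / a + b}.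
Proof. by move=> a b; apply/funext => n; apply: scalerDl. Qed.

HB.instance Definition _ := GRing.Zmodule_isLmodule.Build K B
  ps_scaleA ps_scale1 ps_scaleDr ps_scaleDl.

Lemma ps_scaleAl (a : K) f g : a *: (f * g) = a *: f * g.
Proof.
by apply/funext => n; rewrite [LHS]scaler_sumr; apply: eq_bigr => i _; apply: scalerAl.
Qed.

HB.instance Definition _ := GRing.Lmodule_isLalgebra.Build K B ps_scaleAl.

Lemma ps_scaleAr (a : K) f g : a *: (f * g) = f * (a *: g).
Proof.
by apply/funext => n; rewrite [LHS]scaler_sumr; apply: eq_bigr => i _; apply: scalerAr.
Qed.

HB.instance Definition _ := GRing.Lalgebra_isAlgebra.Build K B ps_scaleAr.

Lemma coef_psD f g n : (f + g) n = f n + g n. Proof. by []. Qed.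
Lemma coef_psM f g n : (f * g) n = \sum_(i < n.+1) f i * g (n - i)%N. Proof. by []. Qed.
Lemma coef_psZ (k : K) f n : (k *: f) n = k *: f n. Proof. by []. Qed.
Lemma coef_ps1 n : (1 : B) n = (n == 0%N)%:R. Proof. by []. Qed.
Lemma coef_ps_sum (I : Type) (r : seq I) (P : pred I) (F : I -> B) n :
  (\sum_(i <- r | P i) F i) n = \sum_(i <- r | P i) F i n.
Proof. by elim/big_rec2: _ => // i y1 y2 _ <-. Qed.

Lemma coef_ps_signM (b : bool) f n : ((-1) ^+ b * f) n = (-1) ^+ b * f n.
Proof. by case: b; rewrite ?expr0 ?expr1 ?mul1r ?mulN1r. Qed.

Variable gr : supercomm_grading A.

Definition ps_gproj (b : bool) (f : B) : B := fun n => gproj gr b (f n).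

Lemma ps_gproj_is_linear b : linear (ps_gproj b).
Proof. by move=> k f g; apply/funext => n; apply: linearP. Qed.

HB.instance Definition _ b := GRing.isLinear.Build K B B _ (ps_gproj b) (ps_gproj_is_linear b).

Lemma ps_gproj_proj a b f : ps_gproj a (ps_gproj b f) = if a == b then ps_gproj b f else 0.
Proof. by apply/funext => n; rewrite [LHS]gproj_proj; case: ifP. Qed.

Lemma ps_gproj_sum f : ps_gproj false f + ps_gproj true f = f.
Proof. by apply/funext => n; apply: gproj_sum. Qed.

Lemma ps_gproj_mul a b f g : ps_gproj a f = f -> ps_gproj b g = g ->
  ps_gproj (a (+) b) (f * g) = f * g.
Proof.
move=> fa gb; apply/funext => n; rewrite /ps_gproj coef_psM.
have fP i : has_parity gr a (f i) by rewrite /has_parity -[in RHS]fa.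
have gP i : has_parity gr b (g i) by rewrite /has_parity -[in RHS]gb.
by apply: parity_sum => i _; apply: parityM (fP _) (gP _) _.
Qed.

Lemma ps_gproj_supercomm a b f g : ps_gproj a f = f -> ps_gproj b g = g ->
  f * g = (-1) ^+ (a && b) * (g * f).
Proof.
move=> fa gb; apply/funext => n; rewrite coef_ps_signM !coef_psM mulr_sumr.
rewrite [RHS](reindex_inj rev_ord_inj); apply: eq_bigr => i _ /=.
rewrite subSS (subKn (leq_ord i)); apply: (gproj_supercomm (s := gr)).
  by rewrite -[in RHS]fa.
by rewrite -[in RHS]gb.
Qed.

Definition ps_grading : supercomm_grading B :=
  @SupercommGrading K B (fun b => ps_gproj b : {linear B -> B})
    ps_gproj_proj ps_gproj_sum ps_gproj_mul ps_gproj_supercomm.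

Lemma ps_parity a f : (forall n, has_parity gr a (f n)) -> has_parity ps_grading a f.
Proof. by move=> h; apply/funext => n; apply: h. Qed.

End PowerSeries.

(** The approximation [F n] is correct below n; the default [t0] never reaches the diagonal. *)
Lemma strong_recursion (T : Type) (t0 : T) (step : nat -> (nat -> T) -> T) :
  (forall n f g, (forall m, (m < n)%N -> f m = g m) -> step n f = step n g) ->
  exists f : nat -> T, forall n, f n = step n f.
Proof.
move=> step_ext; pose F := fix F n := if n is n'.+1 then fun m => step m (F n') else fun=> t0.
have F_stable m n n' : (m < n)%N -> (m < n')%N -> F n m = F n' m.
  elim/ltn_ind: m n n' => m IHm [|n] [|n'] //; rewrite !ltnS => mn mn'.
  by apply: step_ext => k km; apply: IHm => //; [apply: leq_trans mn|apply: leq_trans mn'].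
exists (fun m => F m.+1 m) => n; apply: step_ext => k kn.
exact: F_stable.
Qed.

Section SeriesInverse.
Variables (T : pzRingType) (c : nat -> T).
Hypothesis c0 : c 0%N = 1.

(** The ring is arbitrary because the coefficients will be matrices. As they do not commute, the
    left and right inverses are built separately and then identified. *)
Lemma series_left_inverse : exists l : nat -> T,
  forall n, \sum_(k < n.+1) l k * c (n - k)%N = (n == 0%N)%:R.
Proof.
pose step n (l : nat -> T) := if n is m.+1 then - \sum_(k < m.+1) l k * c (m.+1 - k)%N else 1.
have [|l lE] := @strong_recursion T 0 step.
  by move=> [|n] f g fg //=; congr (- _); apply: eq_bigr => k _; rewrite fg.
exists l => -[|n]; first by rewrite big_ord1 subn0 c0 mulr1 lE.
by rewrite big_ord_recr /= subnn c0 mulr1 [l n.+1]lE subrr.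
Qed.

Lemma series_right_inverse : exists r : nat -> T,
  forall n, \sum_(k < n.+1) c k * r (n - k)%N = (n == 0%N)%:R.
Proof.
pose step n (r : nat -> T) := if n is m.+1 then - \sum_(k < m.+1) c k.+1 * r (m - k)%N else 1.
have [|r rE] := @strong_recursion T 0 step.
  by move=> [|n] f g fg //=; congr (- _); apply: eq_bigr => k _; rewrite fg // ltnS leq_subr.
exists r => -[|n]; first by rewrite big_ord1 subn0 c0 mul1r rE.
by rewrite big_ord_recl c0 mul1r subn0 [r n.+1]rE /= addrC subrr.
Qed.

End SeriesInverse.

Section SeriesMatrices.
Variables (K : fieldType) (A : algType K).
Notation B := (pseries A).

Definition mx_series m n (F : nat -> 'M[A]_(m, n)) : 'M[B]_(m, n) :=
  \matrix_(i, j) ((fun k => F k i j) : B).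

Lemma mx_seriesM m n o (F : nat -> 'M[A]_(m, n)) (G : nat -> 'M[A]_(n, o)) :
  mx_series F *m mx_series G = mx_series (fun k => \sum_(l < k.+1) F l *m G (k - l)%N).
Proof.
apply/matrixP => i j; rewrite !mxE; apply/funext => k; rewrite coef_ps_sum summxE.
under eq_bigr => l _ do rewrite !mxE coef_psM.
rewrite exchange_big; apply: eq_bigr => l _ /=.
by rewrite mxE.
Qed.

Lemma mx_series1 n : mx_series (fun k => ((k == 0%N)%:R : 'M[A]_n)) = 1%:M.
Proof.
apply/matrixP => i j; rewrite !mxE; apply/funext => -[|k] /=.
  by rewrite mulr1n mxE; case: eqP.
by rewrite mulr0n mxE; case: eqP.
Qed.

Lemma mx_series_inverse n (F : nat -> 'M[A]_n) : F 0%N = 1%:M ->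
  exists G, mx_series F *m G = 1%:M /\ G *m mx_series F = 1%:M.
Proof.
move=> F0; have [l lF] := series_left_inverse F0; have [r Fr] := series_right_inverse F0.
have Fr1 : mx_series F *m mx_series r = 1%:M.
  by rewrite mx_seriesM -mx_series1; congr mx_series; apply/funext => k; apply: Fr.
have lF1 : mx_series l *m mx_series F = 1%:M.
  by rewrite mx_seriesM -mx_series1; congr mx_series; apply/funext => k; apply: lF.
exists (mx_series r); split=> //.
by rewrite -[mx_series r]mul1mx -{1}lF1 -(mulmxA (mx_series l)) Fr1 mulmx1.
Qed.

End SeriesMatrices.

(** * Diagonalization over formal power series *)

Section Perturbation.
Variables (K : fieldType) (A : algType K) (gr : supercomm_grading A) (p q : nat).
Notation B := (pseries A).
Notation I := 'I_(p + q).
Variables (d : I -> K) (E : 'M[A]_(p + q)).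
Hypothesis d_inj : injective d.
Hypothesis hE : even_mx gr E.

(* D + s E as a matrix of power series in s *)
Definition perturbed_diag : 'M[B]_(p + q) :=
  mx_series (fun k => if k is k'.+1 then (if k' is 0 then E else 0) else diag_mx (\row_j (d j)%:A)).

(* Comparing coefficients of s^(m+1) in (D + s E) C = C L, with C = 1 + O(s) of
   unit diagonal and L diagonal, determines the off-diagonal entries of C_(m+1)
   and the diagonal L_(m+1) from C_0, ..., C_m.                                *)
Lemma perturbation_series : exists C : nat -> 'M[A]_(p + q), [/\ C 0%N = 1%:M,
  forall m i, C m.+1 i i = 0 &
  forall m i j, i != j -> (d i - d j) *: C m.+1 i j =
    \sum_(k < m) C k.+1 i j * (E *m C (m - k.+1)%N) j j - (E *m C m) i j].
Proof.
pose step n (C : nat -> 'M[A]_(p + q)) : 'M[A]_(p + q) := if n is m.+1 then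
    \matrix_(i, j) if i == j then 0 else (d i - d j)^-1 *:
      (\sum_(k < m) C k.+1 i j * (E *m C (m - k.+1)%N) j j - (E *m C m) i j)
  else 1%:M.
have [|C CE] := @strong_recursion _ 0 step.
  move=> [|m] f g fg //=; apply/matrixP => i j; rewrite !mxE; case: eqP => // _.
  congr (_ *: (_ - _)).
    apply: eq_bigr => k _; rewrite fg ?ltnS //.
    by rewrite (fg (m - k.+1)%N) //; have := ltn_ord k; lia.
  by apply: eq_bigr => k _; rewrite fg.
exists C; split; first exact: CE.
  by move=> m i; rewrite CE mxE eqxx.
move=> m i j ij; rewrite [C m.+1]CE mxE (negPf ij) scalerA divff ?scale1r //.
by rewrite subr_eq0 (inj_eq d_inj).
Qed.

Lemma perturbed_diag_eigenvalues : even_mx (ps_grading gr) perturbed_diag /\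
  exists lam mu, eigenvalues (ps_grading gr) perturbed_diag lam mu.
Proof.
split.
  move=> i j; rewrite mxE; apply: ps_parity => -[|[|k]]; rewrite ?mxE; last exact: parity0.
    case: eqP => [->|_]; last exact: parity0.
    by rewrite mulr1n addbb; apply/parityZ/parity1.
  exact: hE.
have [C [C0 Cdiag Coff]] := perturbation_series.
have eC n : even_mx gr (C n).
  elim/ltn_ind: n => -[|m] IHm i j; first by rewrite C0; apply: homog_mx1.
  have [->|ij] := eqVneq i j; first by rewrite Cdiag; apply: parity0.
  have dij : d i - d j != 0 by rewrite subr_eq0 (inj_eq d_inj).
  rewrite -[C m.+1 i j]scale1r -(mulVf dij) -scalerA Coff //; apply: parityZ.
  have EC k : (k <= m)%N -> even_mx gr (E *m C k) by move=> km; apply: homog_mxM hE (IHm k _).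
  apply: parityB; last exact: EC.
  apply: parity_sum => k _; apply: parityM (IHm k.+1 _ i j) (EC (m - k.+1)%N _ j j) _.
  - by rewrite ltnS.
  - exact: leq_subr.
  - by rewrite addbb addbF.
(* C_(m+1) has zero diagonal, so the diagonal part of the equation reads: L_(m+1) is the diagonal of
   E C_m. *)
pose lam (j : I) : B := fun n => if n is k.+1 then (E *m C k) j j else (d j)%:A.
have lam_even j : has_parity (ps_grading gr) false (lam j).
  apply: ps_parity => -[|k]; first exact/parityZ/parity1.
  by have := homog_mxM hE (eC k) j j; rewrite addbb.
have [G [CG GC]] := mx_series_inverse C0.
exists (\row_i lam (lshift q i)), (\row_a lam (rshift p a)); split.
- by move=> i; rewrite mxE.
- by move=> a; rewrite mxE.
exists (mx_series C), G; split.
  by split=> // i j; rewrite mxE; apply: ps_parity => n; apply: eC.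
have -> : row_mx (\row_i lam (lshift q i)) (\row_a lam (rshift p a)) = \row_j lam j.
  by apply/rowP => j; case: (split_ordP j) => k ->; rewrite ?row_mxEl ?row_mxEr !mxE.
rewrite mul_mx_diag mx_seriesM; apply/matrixP => i j; rewrite !mxE; apply/funext => -[|m].
  rewrite coef_psM !big_ord1 /= C0 mulmx1 !mxE; case: eqP => [->|_].
    by rewrite !mulr1n mul1r.
  by rewrite !mulr0n mul0r.
rewrite coef_psM big_ord_recl big_ord_recl big1 ?addr0 => [|k _]; last by rewrite mul0mx.
rewrite !subn0 /= subSS subn0 mxE mul_diag_mx [X in X + _]mxE [X in X * _]mxE.
(* The extreme terms are those with C_0 = 1 and with L_0. Off the diagonal the former vanishes and
   the rest is the recursion for C_(m+1). *)
rewrite big_ord_recr big_ord_recl /= subnn C0.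
rewrite [X in _ = _ + X + _](_ : _ = \sum_(k < m) C k.+1 i j * (E *m C (m - k.+1)%N) j j); last first.
  by apply: eq_bigr => k _; rewrite /bump add1n subSS -subnSK.
rewrite /lam [1%:M i j]mxE mulr_algl -scalerAr mulr1.
have [->|ij] := eqVneq i j.
  rewrite Cdiag !scaler0 add0r addr0 mul1r big1 ?addr0 // => k _.
  by rewrite Cdiag mul0r.
rewrite mul0r add0r; have := Coff m i j ij; rewrite scalerBl => /eqP.
by rewrite subr_eq addrAC => /eqP ->; rewrite subrK.
Qed.

End Perturbation.

(** * Universal polynomials in the matrix entries *)

Section Universal.
Variables (K : fieldType) (p q : nat).
Hypothesis two_neq0 : 2%:R != 0 :> K.
Notation I := 'I_(p + q).

(* The polynomial does not depend on the superalgebra, so that an identity proved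
   over A[[s]] can be specialized to A.                                        *)
Definition mx_fun := forall (A : algType K), supercomm_grading A -> 'M[A]_(p + q) -> A.
Definition universal (F : mx_fun) := exists P : entry_poly K p q,
  forall (A : algType K) (gr : supercomm_grading A) M, even_mx gr M -> F A gr M = entry_eval P M.

Lemma universal_polynomial (F : mx_fun) (A : algType K) (gr : supercomm_grading A) :
  universal F -> polynomial_fun gr (F A gr).
Proof. by case=> P FP; exists P => M; apply: FP. Qed.

Lemma eq_universal (F G : mx_fun) :
  (forall (A : algType K) (gr : supercomm_grading A) M, even_mx gr M -> F A gr M = G A gr M) ->
  universal G -> universal F.
Proof. by move=> FG [P GP]; exists P => A gr M hM; rewrite FG // GP. Qed.

Lemma universal_const (k : K) : universal (fun A _ _ => k%:A).
Proof. by exists [:: (k, [::])] => A gr M _; rewrite /entry_eval big_seq1 big_nil. Qed.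

Lemma universal_entry i j : universal (fun A _ M => M i j).
Proof. by exists [:: (1, [:: (i, j)])] => A gr M _; rewrite /entry_eval !big_seq1 scale1r. Qed.

Lemma universalD (F G : mx_fun) : universal F -> universal G ->
  universal (fun A gr M => F A gr M + G A gr M).
Proof.
move=> [P FP] [Q GQ]; exists (P ++ Q) => A gr M hM.
by rewrite (FP _ gr) // (GQ _ gr) // /entry_eval big_cat.
Qed.

Lemma universalM (F G : mx_fun) : universal F -> universal G ->
  universal (fun A gr M => F A gr M * G A gr M).
Proof.
move=> [P FP] [Q GQ].
exists [seq (m.1 * n.1, m.2 ++ n.2) | m <- P, n <- Q] => A gr M hM.
rewrite (FP _ gr) // (GQ _ gr) // /entry_eval big_allpairs_dep mulr_suml /=.
apply: eq_bigr => m _; rewrite mulr_sumr; apply: eq_bigr => n _.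
by rewrite big_cat -scalerAl -scalerAr scalerA.
Qed.

Lemma universal0 : universal (fun A _ _ => 0).
Proof. by exists [::] => A gr M _; rewrite /entry_eval big_nil. Qed.

Lemma universal1 : universal (fun A _ _ => 1).
Proof. by apply: eq_universal (universal_const 1) => A gr M _; rewrite scale1r. Qed.

Lemma universal_sum (J : Type) (r : seq J) (F : J -> mx_fun) : (forall j, universal (F j)) ->
  universal (fun A gr M => \sum_(j <- r) F j A gr M).
Proof.
move=> hF; elim: r => [|j r IHr].
  by apply: eq_universal universal0 => A gr M _; rewrite big_nil.
by apply: eq_universal (universalD (hF j) IHr) => A gr M _; rewrite big_cons.
Qed.

Lemma universal_prod (J : Type) (r : seq J) (F : J -> mx_fun) : (forall j, universal (F j)) ->
  universal (fun A gr M => \prod_(j <- r) F j A gr M).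
Proof.
move=> hF; elim: r => [|j r IHr].
  by apply: eq_universal universal1 => A gr M _; rewrite big_nil.
by apply: eq_universal (universalM (hF j) IHr) => A gr M _; rewrite big_cons.
Qed.

Lemma universalX (F : mx_fun) n : universal F -> universal (fun A gr M => F A gr M ^+ n).
Proof.
move=> hF; elim: n => [|n IHn].
  by apply: eq_universal universal1 => A gr M _; rewrite expr0.
by apply: eq_universal (universalM hF IHn) => A gr M _; rewrite exprS.
Qed.

Lemma universal_sign n : universal (fun A _ _ => (-1) ^+ n).
Proof.
apply/universalX/(eq_universal _ (universal_const (-1))) => A gr M _.
by rewrite scaleN1r.
Qed.

Lemma universal_int (k : int) : universal (fun A _ _ => k%:~R).
Proof.
apply: eq_universal (universal_const k%:~R) => A gr M _.
by rewrite scaler_int.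
Qed.

Lemma universal_det n (F : 'I_n -> 'I_n -> mx_fun) : (forall i j, universal (F i j)) ->
  universal (fun A gr M => \det (\matrix_(i, j) F i j A gr M)).
Proof.
move=> hF; apply: universal_sum => s; apply: universalM; first exact: universal_sign.
apply: universal_prod => i.
by apply: eq_universal (hF i (s i)) => A gr M _; rewrite mxE.
Qed.

Lemma universal_tensor_coef (w u : seq I) : universal (fun A gr M => tensor_coef gr M w u).
Proof.
elim: w u => [|y w IHw] [|x u]; try exact: universal0; first exact: universal1.
apply: universalM => //=.
apply: eq_universal (universalM (universal_sign (wpar w && (ipar y (+) ipar x))) (universal_entry y x)).
by move=> A gr M hM; rewrite (twist_homog _ (hM y x)).
Qed.

Lemma universal_ext_trace (k : int) : universal (fun A gr M => ext_trace gr k M).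
Proof.
case: k => [k|k]; last exact: universal0.
apply: eq_universal (fun A gr M hM => ext_traceE two_neq0 k hM) _.
apply: universal_sum => i; apply: universalM; first exact: universal_sign.
pose F : mx_fun := fun A gr M =>
  \sum_(w : (size (ext_word i)).-tuple I) ext_coord A (ext_word i) w * tensor_coef gr M w (ext_word i).
apply: (eq_universal (G := F)) => [A gr M _|]; first by rewrite mxE.
apply: universal_sum => w; apply: universalM; last exact: universal_tensor_coef.
apply: universalM; last exact: universal_int.
by apply: eq_universal (universal_int (perm_eq w (ext_word i))%:R) => A gr M _; rewrite rmorph_nat.
Qed.

Lemma universal_Ptilde_coef k : universal (fun A gr M => (Ptilde_at gr M)`_k).
Proof.
pose F : mx_fun := fun A gr M => mmap (fun c : K => c%:A)
  (fun j : 'I_(nvars p q) => ext_trace gr (j%:Z - q%:Z) M) (Ptilde K p q)`_k.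
apply: (eq_universal (G := F)) => [A gr M _|].
  rewrite /Ptilde_at coef_map_id0 //.
  by rewrite /mmap msupp0 big_nil.
apply: universal_sum => m; apply: universalM; first exact: universal_const.
apply: universal_prod => j; exact/universalX/universal_ext_trace.
Qed.

Lemma universal_mxX i j n : universal (fun A gr M => (M ^+ n) i j).
Proof.
elim: n i j => [|n IHn] i j.
  apply: eq_universal (universal_int (i == j)%:R) => A gr M _.
  by rewrite expr0 mxE rmorph_nat.
pose F : mx_fun := fun A gr M => \sum_(k : I) M i k * (M ^+ n) k j.
apply: (eq_universal (G := F)) => [A gr M _|]; first by rewrite exprS mxE.
by apply: universal_sum => k; apply: universalM; [apply: universal_entry | apply: IHn].
Qed.

Lemma size_Ptilde_at (A : algType K) (gr : supercomm_grading A) (M : 'M[A]_(p + q)) :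
  (size (Ptilde_at gr M) <= (p + q).+1)%N.
Proof. by rewrite -(size_Ptilde K p q); apply: size_poly. Qed.

Lemma universal_mxeval i j :
  universal (fun A gr M => mxeval M (Ptilde_at gr M) i j).
Proof.
pose F : mx_fun := fun A gr M => \sum_(k < (p + q).+1) (Ptilde_at gr M)`_k * (M ^+ k) i j.
apply: (eq_universal (G := F)) => [A gr M _|].
  rewrite (mxeval_widen _ (size_Ptilde_at gr M)) summxE; apply: eq_bigr => k _.
  by rewrite mxE.
apply: universal_sum => k; apply: universalM; first exact: universal_Ptilde_coef.
exact: universal_mxX.
Qed.

Variables (d : I -> K) (A : algType K) (gr : supercomm_grading A) (M : 'M[A]_(p + q)).
Hypothesis d_inj : injective d.
Hypothesis hM : even_mx gr M.
Let D : 'M[A]_(p + q) := diag_mx (\row_j (d j)%:A).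
Let Ms := perturbed_diag d (M - D).

(** Series cannot be evaluated at s = 1 in general, but the entries of D + s (M - D) are polynomials
    in s, and so is every polynomial expression in them. *)
Lemma specialize_perturbed_diag (P : entry_poly K p q) : exists f : {poly A},
  (forall n, entry_eval P Ms n = f`_n) /\ f.[1] = entry_eval P M.
Proof.
pose spec (x : pseries A) a := exists f : {poly A}, (forall n, x n = f`_n) /\ f.[1] = a.
have specD x y a b : spec x a -> spec y b -> spec (x + y) (a + b).
  move=> [f [xf fa]] [g [yg gb]]; exists (f + g); rewrite hornerD fa gb; split=> // n.
  by rewrite coef_psD coefD xf yg.
have specM x y a b : spec x a -> spec y b -> spec (x * y) (a * b).
  move=> [f [xf fa]] [g [yg gb]]; exists (f * g); split=> [n|].
    by rewrite coef_psM coefM; apply: eq_bigr => i _; rewrite xf yg.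
  by rewrite hornerM_comm ?fa ?gb // /comm_poly mulr1 mul1r.
have specZ (k : K) x a : spec x a -> spec (k *: x) (k *: a).
  move=> [f [xf fa]]; exists (k%:A *: f); split=> [n|].
    by rewrite coef_psZ coefZ mulr_algl xf.
  by rewrite hornerZ fa mulr_algl.
have spec1 : spec 1 1 by exists 1; split=> [n|]; rewrite ?hornerC // coef_ps1 coef1.
have spec0 : spec 0 0 by exists 0; split=> [n|]; rewrite ?hornerC // coef0.
have spec_entry i j : spec (Ms i j) (M i j).
  exists ((D i j)%:P + (M i j - D i j) *: 'X); split=> [n|].
    rewrite mxE coefD coefC coefZ coefX.
    by case: n => [|[|n]] //=; rewrite ?mxE ?mulr0 ?mulr1 ?addr0 ?add0r.
  by rewrite hornerD hornerZ hornerC hornerX mulr1 addrC subrK.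
suff: spec (entry_eval P Ms) (entry_eval P M) by [].
rewrite /entry_eval; elim: P => [|m P IHP]; first by rewrite !big_nil.
rewrite !big_cons; apply: specD => //; apply: specZ.
elim: m.2 => [|ij w IHw]; first by rewrite !big_nil.
by rewrite !big_cons; apply: specM.
Qed.

Lemma Ptilde_at_annihilates_even : annihilates (Ptilde_at gr M) M.
Proof.
apply/matrixP => i j; rewrite [RHS]mxE.
have hE : even_mx gr (M - D).
  move=> k l; rewrite !mxE; apply: parityB => //; case: eqP => [->|_]; last exact: parity0.
  by rewrite mulr1n addbb; apply/parityZ/parity1.
have [hMs [lam [mu Meig]]] := perturbed_diag_eigenvalues d_inj hE.
have [lam_even mu_even _] := Meig.
have [lam0 lamE] := lift_row lam_even; have [mu0 muE] := lift_row mu_even.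
rewrite lamE muE in Meig.
have Ms0 := Ptilde_at_annihilates two_neq0 hMs Meig.
(* The same P serves over [A] and over A[[s]]. *)
have [P PE] := universal_mxeval i j.
have [f [fE f1]] := specialize_perturbed_diag P.
rewrite (PE _ gr) // -f1 (_ : f = 0) ?horner0 //; apply/polyP => n.
by rewrite -fE -(PE _ (ps_grading gr)) // Ms0 mxE coef0.
Qed.

End Universal.

(** * The resultant and the naive characteristic polynomial of an operator *)

Section NaivePolynomial.
Variables (K : fieldType) (A : algType K) (gr : supercomm_grading A) (p q : nat).
Hypothesis two_neq0 : 2%:R != 0 :> K.
Implicit Types (M C : 'M[A]_(p + q)).

(** The resultant in the form of [det_toeplitz_trace], which does not presuppose eigenvalues. *)
Definition trace_resultant M : A :=
  \det (\matrix_(i < q, j < q) ext_trace gr (p%:Z + j%:Z - i%:Z) M).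

Definition resultant_inverse M : A :=
  xget 0 [set y | trace_resultant M * y = 1 /\ y * trace_resultant M = 1]%classic.

(** Dividing by the resultant extends the naive characteristic polynomial to operators without
    eigenvalues. Where the resultant is not invertible, [xget] gives 0 for its inverse. *)
Definition naive_poly M : {poly A} :=
  (-1) ^+ 'C(q, 2) *: (resultant_inverse M *: Ptilde_at gr M).

Lemma resultant_inverseP M : invertible (trace_resultant M) ->
  trace_resultant M * resultant_inverse M = 1 /\ resultant_inverse M * trace_resultant M = 1.
Proof. exact: (xgetPex 0). Qed.

Lemma trace_resultant_even M : even_mx gr M -> has_parity gr false (trace_resultant M).
Proof.
move=> hM; apply: parity_sum => s _; apply: parity_signM.
by apply: parity_prod => i _; rewrite mxE; apply: ext_trace_even.
Qed.

Lemma trace_resultant_conj M C Ci : even_mx gr M -> even_invertible_mx gr C Ci ->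
  trace_resultant (Ci *m M *m C) = trace_resultant M.
Proof.
move=> hM hC; congr (\det _); apply/matrixP => i j; rewrite !mxE.
exact: ext_trace_conj.
Qed.

Lemma Ptilde_at_conj M C Ci : even_mx gr M -> even_invertible_mx gr C Ci ->
  Ptilde_at gr (Ci *m M *m C) = Ptilde_at gr M.
Proof.
move=> hM hC; rewrite /Ptilde_at; congr (map_poly (mmap _ _) _).
by apply/funext => j; apply: ext_trace_conj.
Qed.

Lemma naive_poly_conj M C Ci : even_mx gr M -> even_invertible_mx gr C Ci ->
  naive_poly (Ci *m M *m C) = naive_poly M.
Proof.
move=> hM hC; rewrite /naive_poly /resultant_inverse.
by rewrite (trace_resultant_conj hM hC) (Ptilde_at_conj hM hC).
Qed.

Lemma Ptilde_at_naive_poly M : invertible (trace_resultant M) ->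
  Ptilde_at gr M = (-1) ^+ 'C(q, 2) *: (trace_resultant M *: naive_poly M).
Proof.
move=> /resultant_inverseP[RR' _]; rewrite /naive_poly !scalerA -!mulrA.
rewrite (mulrA (trace_resultant M)) commr_sign -!mulrA RR' mulr1 -exprD addnn.
by rewrite -signr_odd odd_double scale1r.
Qed.

Lemma polynomial_trace_resultant :
  polynomial_fun gr trace_resultant.
Proof.
pose F : mx_fun K p q := fun B grB N =>
  \det (\matrix_(i < q, j < q) ext_trace grB (p%:Z + j%:Z - i%:Z) N).
have uF : universal F by apply: universal_det => i j; apply: universal_ext_trace.
exact: (universal_polynomial gr uF).
Qed.

(** The polynomial expressing the resultant is a common denominator for all coefficients. *)
Lemma rational_naive_poly k :
  rational_fun gr (fun M => invertible (trace_resultant M)) (fun M => (naive_poly M)`_k).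
Proof.
have [Q QE] := polynomial_trace_resultant.
have [P PE] := universal_polynomial gr
  (universalM (universal_sign K p q 'C(q, 2)) (universal_Ptilde_coef p q two_neq0 k)).
exists P, Q => M hM RM; rewrite -QE // -PE //; split=> //.
have [_ R'R] := resultant_inverseP RM.
rewrite !coefZ -mulrA; congr (_ * _).
rewrite -mulrA -(even_central _ (trace_resultant_even hM)) mulrA R'R.
exact: mul1r.
Qed.

End NaivePolynomial.

Theorem proposition6 (R : realType) (A : algType R[i]) (gr : supercomm_grading A)
    (p q : nat) :
  size (Ptilde R[i] p q) = (p + q).+1 /\
  (* (1) *)
  ((forall M : 'M[A]_(p + q), even_mx gr M -> annihilates (Ptilde_at gr M) M) /\
   (forall k : nat,
      invariant_fun gr (fun=> True) (fun M : 'M[A]_(p + q) => (Ptilde_at gr M)`_k) /\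
      polynomial_fun gr (fun M : 'M[A]_(p + q) => (Ptilde_at gr M)`_k))) /\
  (* (2) *)
  (forall (M : 'M[A]_(p + q)) (lam : 'rV[A]_p) (mu : 'rV[A]_q),
     even_mx gr M -> eigenvalues gr M lam mu -> generic lam mu ->
     minimal_poly (Ptilde_at gr M) M /\
     (forall f : {poly A}, annihilates f M ->
        exists g : {poly A}, f = g * Ptilde_at gr M)) /\
  (* (3) *)
  (exists (Rfun : 'M[A]_(p + q) -> A) (Pfun : 'M[A]_(p + q) -> {poly A}),
     let D := fun M : 'M[A]_(p + q) => invertible (Rfun M) in
     [/\ (forall (M : 'M[A]_(p + q)) (lam : 'rV[A]_p) (mu : 'rV[A]_q),
            even_mx gr M -> eigenvalues gr M lam mu ->
            [/\ Ptilde_at gr M =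
                  (-1) ^+ 'C(q, 2) *: (eigen_resultant lam mu *: naive_charpoly lam mu),
                eigen_resultant lam mu =
                  formal_resultant q p (charfactor mu) (charfactor lam),
                Rfun M = eigen_resultant lam mu &
                D M -> Pfun M = naive_charpoly lam mu]),
         invariant_fun gr (fun=> True) Rfun /\ polynomial_fun gr Rfun,
         (forall k : nat, invariant_fun gr D (fun M => (Pfun M)`_k) /\
                          rational_fun gr D (fun M => (Pfun M)`_k)) &
         (forall M : 'M[A]_(p + q), even_mx gr M -> D M ->
            Ptilde_at gr M = (-1) ^+ 'C(q, 2) *: (Rfun M *: Pfun M))]).
Proof.
(* Characteristic 0 enters twice: 2 is invertible, and the natural numbers give p + q distinct
   eigenvalues of D. *)
have two_neq0 : 2%:R != 0 :> R[i] by rewrite Num.Theory.pnatr_eq0.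
pose d (i : 'I_(p + q)) : R[i] := (i : nat)%:R.
have d_inj : injective d.
  by move=> i j /eqP; rewrite Num.Theory.eqr_nat => /eqP/val_inj.
split; first exact: size_Ptilde.
split; first split.
- by move=> M hM; apply: (Ptilde_at_annihilates_even two_neq0 d_inj hM).
- move=> k; split; first by move=> M C Ci hM hC _; rewrite (Ptilde_at_conj two_neq0 hM hC).
  exact: universal_polynomial (universal_Ptilde_coef p q two_neq0 k).
split.
  move=> M lam mu hM Meig; have [lam_even mu_even _] := Meig.
  have [lam0 lamE] := lift_row lam_even; have [mu0 muE] := lift_row mu_even.
  by rewrite lamE muE in Meig *; apply: Ptilde_at_minimal.
exists (@trace_resultant _ A gr p q), (@naive_poly _ A gr p q); split.
- move=> M lam mu hM Meig; have [lam_even mu_even _] := Meig.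
  have [lam0 lamE] := lift_row lam_even; have [mu0 muE] := lift_row mu_even.
  rewrite lamE muE in Meig *.
  have RE := det_toeplitz_trace two_neq0 hM Meig; have PE := Ptilde_at_eigen two_neq0 hM Meig.
  split=> //; first by rewrite eigen_resultantE formal_resultantE.
  move=> /resultant_inverseP[_ R'R]; rewrite /naive_poly PE -RE -/(trace_resultant gr M).
  rewrite !scalerA -!mulrA (mulrA (resultant_inverse gr M)) commr_sign -!mulrA R'R mulr1.
  by rewrite -exprD addnn -signr_odd odd_double scale1r.
- split; last exact: polynomial_trace_resultant.
  by move=> M C Ci hM hC _; rewrite (trace_resultant_conj two_neq0 hM hC).
- move=> k; split; last exact: rational_naive_poly.
  by move=> M C Ci hM hC; rewrite (trace_resultant_conj two_neq0 hM hC) (naive_poly_conj two_neq0 hM hC).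
- by move=> M _; apply: Ptilde_at_naive_poly.
Qed.
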